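(* Let $(\Theta,d)$ be a connected metric space indexing the family $\{p_\theta\}_{\theta\in\Theta}$, and let $x_1,x_2,\dots$ be i.i.d. samples from $w$. Suppose $(\theta,x,y)\mapsto V_\theta(x,y)$ is jointly continuous on $\Theta\times G\times G$ and $\sup_{\theta\in K}V_\theta(x,x)$ is $w$-integrable for every compact $K\subset\Theta$. Then $\mathrm{wKSD}_n^2(\theta)\to\mathrm{KSD}^2(\theta)$ compactly almost surely; that is, for every compact $K\subset\Theta$, as $n\to\infty$, $$\mathrm{wKSD}_n^2(\theta)\to\mathrm{KSD}^2(\theta)\ \text{ uniformly on }K,\ \text{ almost surely}.$$ As a corollary, if $\Theta$ is locally compact, then $\mathrm{wKSD}_n$ and $\mathrm{KSD}$ are all continuous on $\Theta$.
   Context: $G$ is a connected Lie group with left-invariant Haar measure $\mu$, of dimension $m$; all densities are with respect to $\mu$. The modular function $\Delta:G\to(0,\infty)$ is defined by $\mu(Sg)=\Delta(g)\mu(S)$ for Borel sets $S$. $D^1,\dots,D^m$ is a left-invariant basis (left-invariant vector fields forming a basis of the tangent space at every point). $k:G\times G\to\mathbb{R}$ is a positive definite kernel with reproducing kernel Hilbert space $\mathcal{H}_k$; $k$ is $C_0$-universal if $\mathcal{H}_k$ is contained in, and dense in sup norm in, the space $C_0(G)$ of continuous functions vanishing at infinity. $\mathcal{H}_k^m$ is the $m$-fold product with $\langle f,g\rangle_{\mathcal{H}_k^m}=\sum_l\langle f_l,g_l\rangle_{\mathcal{H}_k}$. For a locally Lipschitz probability density $p$ and $h\in\mathcal{H}_k$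 put $\mathcal{A}^l_ph:=D^lh+h\,D^l\log p+h\,D^l\log\Delta$ ($D^l\log p:=0$ where $p=0$); for $f\in\mathcal{H}_k^m$ put $\mathcal{A}_pf:=\sum_l\mathcal{A}^l_pf_l$. Put $\mathrm{KSD}(p,q):=\sup\{\mathbb{E}_q[\mathcal{A}_pf]:f\in\mathcal{H}_k^m,\|f\|_{\mathcal{H}_k^m}\le1\}$. Let $\mathcal{A}^l_pk_x\in\mathcal{H}_k$ be obtained by letting $\mathcal{A}^l_p$ act on the first argument of $k$ and fixing that argument at $x$, and put $k_p(x,y):=\sum_l\langle\mathcal{A}^l_pk_x,\mathcal{A}^l_pk_y\rangle_{\mathcal{H}_k}$. $\{p_\theta\}$ is a family of locally Lipschitz probability densities on $G$, $q$ a locally Lipschitz probability density, and $w$ a strictly positive probability density (the sampling density). Write $\mathrm{KSD}(\theta):=\mathrm{KSD}(p_\theta,q)$, $$V_\theta(x,y):=k_{p_\theta}(x,y)\,q(x)q(y)w(x)^{-1}w(y)^{-1},\qquad \mathrm{wKSD}_n^2(\theta):=\frac1{n^2}\sum_{i,j=1}^nV_\theta(x_i,x_j),$$ and $\mathrm{wKSD}_n(\theta)\ge0$ is the square root of the latter. Standing assumptions: $k\in C^2(G\times G)$ is $C_0$-universal, and for every $\theta$ the functions $\sqrt{k_{p_\theta}(x,x)}$ and $D^l\log(p_\theta/q)$ (all $l$) are integrable with respect to both $p_\theta$ and $q$. *)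

(* Defs.v *)
From HB Require Import structures.
From mathcomp Require Import all_boot all_order all_algebra.
From mathcomp Require Import all_classical all_reals all_analysis.

Set Implicit Arguments.
Unset Strict Implicit.
Unset Printing Implicit Defensive.

Import Order.TTheory GRing.Theory Num.Theory.
Import numFieldNormedType.Exports.

Local Open Scope classical_set_scope.
Local Open Scope ring_scope.

(* [Ck n A f], for [A] open: [f] has continuous iterated directional
   derivatives up to order [n] at every point of [A]. When [V] is
   finite-dimensional this is the usual class C^n on [A]. *)
Fixpoint Ck (R : realType) (V W : normedModType R) (n : nat) (A : set V)
    (f : V -> W) : Prop :=
  (forall x, A x -> {for x, continuous f}) /\
  (if n is n'.+1 then
     forall v, (forall x, A x -> derivable f x v) /\ Ck n' A ('D_v f)
   else True).

Definition smooth_on (R : realType) (V W : normedModType R) (A : set V)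
    (f : V -> W) := forall n, Ck n A f.

(* A homeomorphism from the open set [chart_dom] onto the open set
   [chart_cod] of R^m; [chart_map] and [chart_inv] are total functions whose
   values off these sets are irrelevant. *)
Record chart (R : realType) (m : nat) (G : topologicalType) := Chart {
  chart_dom : set G ;
  chart_cod : set 'rV[R]_m ;
  chart_map : G -> 'rV[R]_m ;
  chart_inv : 'rV[R]_m -> G ;
  chart_dom_open : open chart_dom ;
  chart_cod_open : open chart_cod ;
  chart_map_cod : forall x, chart_dom x -> chart_cod (chart_map x) ;
  chart_inv_dom : forall u, chart_cod u -> chart_dom (chart_inv u) ;
  chart_mapK : forall x, chart_dom x -> chart_inv (chart_map x) = x ;
  chart_invK : forall u, chart_cod u -> chart_map (chart_inv u) = u ;
  chart_map_continuous :
    forall x, chart_dom x -> {for x, continuous chart_map} ;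
  chart_inv_continuous :
    forall u, chart_cod u -> {for u, continuous chart_inv} }.

#[short(type="pretopGroupType")]
HB.structure Definition PreTopologicalGroup :=
  {G of PointedTopological G & Group G}.

(* Lie groups of dimension [m]. The smooth structure is the one generated by
   the atlas of all the [chart_at x]. The base point is only there because
   measurable types are pointed. *)
HB.mixin Record isLieGroup (R : realType) (m : nat) G
    of PreTopologicalGroup G := {
  chart_at : G -> chart R m G ;
  chart_at_dom : forall x, chart_dom (chart_at x) x ;
  chart_at_smooth : forall x y : G,
    smooth_on (chart_cod (chart_at x) `&`
               chart_inv (chart_at x) @^-1` chart_dom (chart_at y))
              (fun u => chart_map (chart_at y) (chart_inv (chart_at x) u)) ;
  lie_hausdorff : hausdorff_space G ;
  lie_second_countable : @second_countable G ;
  lie_mul_continuous : continuous (fun z : G * G => (z.1 * z.2)%g) ;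
  lie_inv_continuous : continuous (fun x : G => (x^-1)%g) ;
  lie_mul_smooth : forall x y z : G,
    smooth_on
      [set u : 'rV[R]_m * 'rV[R]_m |
        [/\ chart_cod (chart_at x) u.1, chart_cod (chart_at y) u.2 &
            chart_dom (chart_at z)
              (chart_inv (chart_at x) u.1 * chart_inv (chart_at y) u.2)%g]]
      (fun u => chart_map (chart_at z)
        (chart_inv (chart_at x) u.1 * chart_inv (chart_at y) u.2)%g) ;
  lie_inv_smooth : forall x y : G,
    smooth_on
      [set u | chart_cod (chart_at x) u /\
               chart_dom (chart_at y) ((chart_inv (chart_at x) u)^-1)%g]
      (fun u => chart_map (chart_at y) ((chart_inv (chart_at x) u)^-1)%g) }.

#[short(type="lieGroupType")]
HB.structure Definition LieGroup (R : realType) (m : nat) :=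
  {G of PreTopologicalGroup G & isLieGroup R m G}.

Section LieCalculus.
Context {R : realType} {m : nat} {G : lieGroupType R m}.
Implicit Types (X : G -> 'rV[R]_m) (h : G -> R) (x g : G).

(* The tangent space at [x] is identified with R^m through [chart_at x]; a
   vector field is thus a function [X : G -> 'rV_m], acting on functions by
   [lie_deriv X]. *)
Definition lie_deriv X h x : R :=
  'D_(X x) (fun u => h (chart_inv (chart_at x) u)) (chart_map (chart_at x) x).

(* The differential of the left translation by [g] maps [X x] to [X (g x)].
   Smoothness of [X] follows. *)
Definition left_invariant X := forall g x,
  'D_(X x) (fun u => chart_map (chart_at (g * x)%g)
                       (g * chart_inv (chart_at x) u)%g)
    (chart_map (chart_at x) x) = X (g * x)%g.

Definition left_invariant_basis (D : 'I_m -> G -> 'rV[R]_m) :=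
  (forall l, left_invariant (D l)) /\
  (forall x, (\matrix_(l < m) D l x) \in unitmx).

Definition locally_lipschitz h := forall x,
  exists2 U, nbhs (chart_map (chart_at x) x) U &
    [lipschitz (h (chart_inv (chart_at x) u)) | u in U].

Definition C2_kernel (k : G -> G -> R) := forall x y,
  Ck 2 (chart_cod (chart_at x) `*` chart_cod (chart_at y))
    (fun u : 'rV[R]_m * 'rV[R]_m =>
       k (chart_inv (chart_at x) u.1) (chart_inv (chart_at y) u.2) : R).

(* X log h, set to 0 where h vanishes. At a point where the derivative of a
   (merely locally Lipschitz) h does not exist, the default value of ['D_]
   is used; such points form a null set. *)
Definition dlog X h x : R :=
  if h x == 0 then 0 else lie_deriv X (fun y => ln (h y)) x.

End LieCalculus.

Notation borel G := (g_sigma_algebraType (@open G)).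

Section Haar.
Context {R : realType} {m : nat} {G : lieGroupType R m}.
Variable mu : {measure set (borel G) -> \bar R}.

(* [G] is second countable, so that regularity is automatic. *)
Definition left_haar :=
  [/\ forall (g : G) (A : set (borel G)), measurable A ->
        mu [set (g * x)%g | x in A] = mu A,
      forall K : set G, compact K -> (mu K < +oo)%E
    & mu setT != 0%E].

Definition modular_function (Delta : G -> R) :=
  (forall g, 0 < Delta g) /\
  forall (g : G) (A : set (borel G)), measurable A ->
    mu [set (x * g)%g | x in A] = ((Delta g)%:E * mu A)%E.

Definition density (p : G -> R) :=
  [/\ forall x, 0 <= p x,
      measurable_fun setT (p : borel G -> R)
    & (\int[mu]_x (p x)%:E = 1)%E].

(* Integrability of [f] with respect to the measure of density [p]. *)
Definition integrable_wrt (p f : G -> R) :=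
  mu.-integrable setT (fun x : borel G => (f x * p x)%:E).

End Haar.

Definition positive_definite (R : realType) (T : Type) (k : T -> T -> R) :=
  (forall x y, k x y = k y x) /\
  forall n (x : 'I_n -> T) (c : 'I_n -> R),
    0 <= \sum_i \sum_j c i * c j * k (x i) (x j).

(* The reproducing kernel Hilbert space of [k], which is unique; [dotH] is
   meaningful on [rkhs_set] only. *)
Record rkhs (R : realType) (T : Type) (k : T -> T -> R) := Rkhs {
  rkhs_set : set (T -> R) ;
  dotH : (T -> R) -> (T -> R) -> R ;
  rkhs0 : rkhs_set (fun=> 0) ;
  rkhs_lin : forall a f g, rkhs_set f -> rkhs_set g ->
    rkhs_set (fun x => a * f x + g x) ;
  dotH_lin : forall a f g h, rkhs_set f -> rkhs_set g -> rkhs_set h ->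
    dotH (fun x => a * f x + g x) h = a * dotH f h + dotH g h ;
  dotH_sym : forall f g, rkhs_set f -> rkhs_set g -> dotH f g = dotH g f ;
  dotH_ge0 : forall f, rkhs_set f -> 0 <= dotH f f ;
  dotH_eq0 : forall f, rkhs_set f -> dotH f f = 0 -> f = (fun=> 0) ;
  rkhs_complete : forall u : nat -> T -> R,
    (forall n, rkhs_set (u n)) ->
    (forall e : R, 0 < e -> exists N, forall i j, (N <= i)%N -> (N <= j)%N ->
       dotH (u i \- u j) (u i \- u j) < e) ->
    exists2 f, rkhs_set f &
      (fun n => dotH (u n \- f) (u n \- f)) @ \oo --> (0 : R) ;
  rkhs_kernel : forall x, rkhs_set (k x) ;
  rkhs_reproducing : forall f x, rkhs_set f -> dotH f (k x) = f x }.

Definition C0 (R : realType) (T : topologicalType) : set (T -> R) :=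
  [set f | continuous f /\
    forall e : R, 0 < e ->
      exists2 K, compact K & forall x, ~ K x -> `|f x| < e].

Definition C0_universal (R : realType) (T : topologicalType)
    (k : T -> T -> R) (H : rkhs k) :=
  (rkhs_set H `<=` @C0 R T) /\
  forall (f : T -> R) (e : R), @C0 R T f -> 0 < e ->
    exists2 h, rkhs_set H h & forall x, `|f x - h x| < e.

Section Stein.
Context {R : realType} {m : nat} {G : lieGroupType R m}.
Variables (mu : {measure set (borel G) -> \bar R}) (Delta : G -> R).
Variable D : 'I_m -> G -> 'rV[R]_m.
Variables (k : G -> G -> R) (H : rkhs k).
Implicit Types (p q w h : G -> R).

Definition stein_dir p (l : 'I_m) h (x : G) : R :=
  lie_deriv (D l) h x + h x * dlog (D l) p x + h x * dlog (D l) Delta x.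

Definition stein p (f : 'I_m -> G -> R) (x : G) : R :=
  \sum_l stein_dir p l (f l) x.

Definition KSD p q : \bar R :=
  ereal_sup [set (\int[mu]_x (stein p f x * q x)%:E)%E |
    f in [set f : 'I_m -> G -> R |
      (forall l, rkhs_set H (f l)) /\ Num.sqrt (\sum_l dotH H (f l) (f l)) <= 1]].

Definition stein_feature p (l : 'I_m) (x : G) : G -> R :=
  fun y => stein_dir p l (fun z => k z y) x.

Definition stein_kernel p (x y : G) : R :=
  \sum_l dotH H (stein_feature p l x) (stein_feature p l y).

Definition Vstat p q w (x y : G) : R :=
  stein_kernel p x y * q x * q y * (w x)^-1 * (w y)^-1.

(* The sample x_1, ..., x_n is [x 0, ..., x n.-1]. *)
Definition wKSD2 p q w (n : nat) (x : nat -> G) : R :=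
  (n%:R ^+ 2)^-1 * \sum_(i < n) \sum_(j < n) Vstat p q w (x i) (x j).

Definition wKSD p q w (n : nat) (x : nat -> G) : R :=
  Num.sqrt (wKSD2 p q w n x).

End Stein.

Definition iid_samples (R : realType) (m : nat) (G : lieGroupType R m)
    (mu : {measure set (borel G) -> \bar R}) (w : G -> R)
    (d : measure_display) (Omega : measurableType d) (P : probability Omega R)
    (X : nat -> {RV P >-> borel G}) :=
  (forall i (A : set (borel G)), measurable A ->
     distribution P (X i) A = (\int[mu]_(x in A) (w x)%:E)%E) /\
  (forall (s : seq nat) (A : nat -> set (borel G)), uniq s ->
     (forall i, measurable (A i)) ->
     P (\bigcap_(i in [set` s]) (X i @^-1` A i)) =
       (\prod_(i <- s) P (X i @^-1` A i))%E).

(* Main.v *)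
Require Import Defs.
From HB Require Import structures.
From mathcomp Require Import all_boot all_order all_algebra.
From mathcomp Require Import all_classical all_reals all_analysis.
From mathcomp Require Import measurable_realfun ring lra.

(** KSD and wKSD_n are both norms of vectors of the product space H^m, and a
    norm is a supremum of linear functionals over the unit ball. This turns the
    convergence of V-statistics into a uniform law of large numbers.

    Since k is C^2, applying the Stein operator and evaluating at x is a
    bounded functional on H, represented by the function A^l_p k_x
    ([stein_feature_representer]). Let eta_x be the vector of H^m with
    components (q x / w x) A^l_p k_x. Then V(x, y) = <eta_x, eta_y>, and the
    function h_f(x) = <f, eta_x> satisfies h_f w = (A_p f) q. Writing nu for
    the law w mu of the sample,

      KSD(theta)    = sup_{|f| <= 1} (integral of h_f against nu),
      wKSD_n(theta) = |mean of the eta_{x_i}|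
                    = sup_{|f| <= 1} (mean of the h_f(x_i)).

    So the distance between the two is at most the largest deviation between
    the sample mean and the true mean of a function of the class F_K of all
    h_f with |f| <= 1 and theta in K ([wKSD_KSD_dist]). By Cauchy-Schwarz,
    F_K has the envelope sqrt (sup_K V(x, x)), square-integrable against nu by
    assumption, and

      |h_f(x) - h_f(c)|^2 <= V(x, x) - 2 V(x, c) + V(c, c),

    where the right-hand side is small for x near c, uniformly in theta in K,
    because V is continuous and K is compact ([witnesses_equicontinuous]).

    A pointwise equicontinuous class with a square-integrable envelope on a
    second countable space obeys the strong law uniformly
    ([uniform_strong_law]): the space splits into countably many cells on
    which every member of the class varies by at most e; up to e, a function
    of the class is thus a combination of indicators of finitely many cells,
    plus a remainder bounded by the restriction of the envelope to the other
    cells, whose integral is small. What is left is the ordinary strong law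
    for the indicators and for that restriction. As these functions are
    nonnegative and square-integrable, it follows from the second moments of
    the sums along the squares n = j^2 and from monotonicity in between
    ([strong_law]).

    Near a point with a compact neighbourhood, KSD is continuous as a uniform
    limit of the continuous functions wKSD_n, taken at one outcome of the
    almost sure event. *)

Set Implicit Arguments.
Unset Strict Implicit.
Unset Printing Implicit Defensive.

Import Order.TTheory GRing.Theory Num.Theory.
Import numFieldNormedType.Exports.

Local Open Scope classical_set_scope.
Local Open Scope ring_scope.

(** * Cauchy-Schwarz in a reproducing kernel Hilbert space and in its powers *)

(** Evaluate the quadratic at its minimum -b / a; if a = 0 it is affine, and an
    affine function bounded below has slope 0. *)
Lemma discriminant_le (R : realFieldType) (a b c : R) : 0 <= a ->
  (forall t, 0 <= t ^+ 2 * a + 2 * t * b + c) -> b ^+ 2 <= a * c.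
Proof.
move=> a0 hq; have [a_eq0|a_neq0] := eqVneq a 0.
  rewrite a_eq0 mul0r.
  have [->|b0] := eqVneq b 0; first by rewrite expr0n.
  have := hq (- (c + 1) / (2 * b)).
  rewrite a_eq0 mulr0 add0r.
  have -> : 2 * (- (c + 1) / (2 * b)) * b + c = -1 by field.
  by rewrite oppr_ge0 ler10.
have a_gt0 : 0 < a by rewrite lt_def a_neq0.
have := hq (- b / a).
have -> : (- b / a) ^+ 2 * a + 2 * (- b / a) * b + c = (a * c - b ^+ 2) / a.
  by field.
by rewrite pmulr_lge0 ?invr_gt0// subr_ge0.
Qed.

Section RKHS.
Context {R : realType} {T : Type} {k : T -> T -> R} (H : rkhs k).
Implicit Types f g h : T -> R.

Lemma rkhsB f g : rkhs_set H f -> rkhs_set H g -> rkhs_set H (f \- g).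
Proof.
move=> Hf Hg; have := rkhs_lin (-1) Hg Hf.
by congr (rkhs_set H); apply/funext => x /=; ring.
Qed.

Lemma rkhsZ a f : rkhs_set H f -> rkhs_set H (fun x => a * f x).
Proof.
move=> Hf; have := rkhs_lin a Hf (rkhs0 H).
by congr (rkhs_set H); apply/funext => x /=; ring.
Qed.

Lemma rkhsD f g : rkhs_set H f -> rkhs_set H g -> rkhs_set H (f \+ g).
Proof.
move=> Hf Hg; have := rkhs_lin 1 Hf Hg.
by congr (rkhs_set H); apply/funext => x /=; ring.
Qed.

Lemma dotH0l f : rkhs_set H f -> dotH H (fun=> 0) f = 0.
Proof.
move=> Hf; have := dotH_lin (-1) (rkhs0 H) (rkhs0 H) Hf.
have -> : (fun _ : T => -1 * 0 + 0 : R) = (fun=> 0).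
  by apply/funext => x; ring.
by move=> ->; ring.
Qed.

Lemma dotHZl a f h : rkhs_set H f -> rkhs_set H h ->
  dotH H (fun x => a * f x) h = a * dotH H f h.
Proof.
move=> Hf Hh; have := dotH_lin a Hf (rkhs0 H) Hh.
rewrite dotH0l// addr0 => <-; congr (dotH H _ h).
by apply/funext => x; rewrite addr0.
Qed.

Lemma dotHZr a f h : rkhs_set H f -> rkhs_set H h ->
  dotH H h (fun x => a * f x) = a * dotH H h f.
Proof.
move=> Hf Hh; rewrite dotH_sym ?dotHZl 1?dotH_sym//.
exact: rkhsZ.
Qed.

Lemma dotHDl f g h : rkhs_set H f -> rkhs_set H g -> rkhs_set H h ->
  dotH H (f \+ g) h = dotH H f h + dotH H g h.
Proof.
move=> Hf Hg Hh; have := dotH_lin 1 Hf Hg Hh.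
rewrite mul1r => <-; congr (dotH H _ h).
by apply/funext => x; rewrite mul1r.
Qed.

Lemma dotHDr f g h : rkhs_set H f -> rkhs_set H g -> rkhs_set H h ->
  dotH H h (f \+ g) = dotH H h f + dotH H h g.
Proof.
move=> Hf Hg Hh; rewrite dotH_sym ?dotHDl// 1?(dotH_sym Hf)// 1?(dotH_sym Hg)//.
exact: rkhsD.
Qed.

Lemma dotHBl f g h : rkhs_set H f -> rkhs_set H g -> rkhs_set H h ->
  dotH H (f \- g) h = dotH H f h - dotH H g h.
Proof.
move=> Hf Hg Hh; have := dotH_lin (-1) Hg Hf Hh.
rewrite mulN1r addrC => <-; congr (dotH H _ h).
by apply/funext => x /=; ring.
Qed.

Lemma dotHBr f g h : rkhs_set H f -> rkhs_set H g -> rkhs_set H h ->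
  dotH H h (f \- g) = dotH H h f - dotH H h g.
Proof.
move=> Hf Hg Hh; rewrite dotH_sym ?dotHBl// 1?(dotH_sym Hf)// 1?(dotH_sym Hg)//.
exact: rkhsB.
Qed.

Lemma dotH_sqB f g : rkhs_set H f -> rkhs_set H g ->
  dotH H (f \- g) (f \- g) = dotH H f f - 2 * dotH H f g + dotH H g g.
Proof.
move=> Hf Hg; rewrite dotHBl ?dotHBr//; last exact: rkhsB.
rewrite (dotH_sym Hg Hf); ring.
Qed.

(** Parallelogram law, used as a triangle inequality that avoids square roots. *)
Lemma dotH_sqB_le f g h : rkhs_set H f -> rkhs_set H g -> rkhs_set H h ->
  dotH H (f \- h) (f \- h) <=
  2 * (dotH H (f \- g) (f \- g) + dotH H (g \- h) (g \- h)).
Proof.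
move=> Hf Hg Hh.
have Ha := rkhsB Hf Hg; have Hb := rkhsB Hg Hh.
have := dotH_ge0 (rkhsB Ha Hb); rewrite (dotH_sqB Ha Hb) => ge0.
have -> : f \- h = (f \- g) \+ (g \- h) by apply/funext => x /=; ring.
rewrite (dotHDl Ha Hb (rkhsD Ha Hb)) (dotHDr Ha Hb Ha) (dotHDr Ha Hb Hb).
rewrite (dotH_sym Hb Ha); lra.
Qed.

Lemma dotH_CauchySchwarz f g : rkhs_set H f -> rkhs_set H g ->
  dotH H f g ^+ 2 <= dotH H f f * dotH H g g.
Proof.
move=> Hf Hg; apply: discriminant_le; first exact: dotH_ge0.
move=> t; have Htf := rkhsZ t Hf.
have := dotH_ge0 (rkhsD Htf Hg).
rewrite dotHDl ?dotHDr// ?dotHZl ?dotHZr// ?dotHZr//; last exact: rkhsD.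
by rewrite (dotH_sym Hg Hf); congr (0 <= _); ring.
Qed.

End RKHS.

Section ProductRKHS.
Context {R : realType} {T : Type} {k : T -> T -> R} (H : rkhs k) {m : nat}.
Implicit Types f g : 'I_m -> T -> R.

Definition rkhs_prod f := forall l, rkhs_set H (f l).
(** Vectors of H^m are families indexed by the directions; this inner product is
    meaningful on [rkhs_prod] only, as [dotH] is on [rkhs_set]. *)
Definition dot_prod f g : R := \sum_l dotH H (f l) (g l).

Lemma dot_prod_ge0 f : rkhs_prod f -> 0 <= dot_prod f f.
Proof. by move=> Hf; apply: sumr_ge0 => l _; exact: dotH_ge0. Qed.

Lemma dot_prodZl a f g : rkhs_prod f -> rkhs_prod g ->
  dot_prod (fun l x => a * f l x) g = a * dot_prod f g.
Proof.
by move=> Hf Hg; rewrite /dot_prod mulr_sumr; apply: eq_bigr => l _; exact: dotHZl.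
Qed.

Lemma dot_prodZr a f g : rkhs_prod f -> rkhs_prod g ->
  dot_prod g (fun l x => a * f l x) = a * dot_prod g f.
Proof.
by move=> Hf Hg; rewrite /dot_prod mulr_sumr; apply: eq_bigr => l _; exact: dotHZr.
Qed.

Lemma dot_prodBr f g h : rkhs_prod f -> rkhs_prod g -> rkhs_prod h ->
  dot_prod h (fun l => f l \- g l) = dot_prod h f - dot_prod h g.
Proof.
by move=> Hf Hg Hh; rewrite /dot_prod -sumrB; apply: eq_bigr => l _; exact: dotHBr.
Qed.

Lemma dot_prod_sqB f g : rkhs_prod f -> rkhs_prod g ->
  dot_prod (fun l => f l \- g l) (fun l => f l \- g l) =
  dot_prod f f - 2 * dot_prod f g + dot_prod g g.
Proof.
move=> Hf Hg; rewrite /dot_prod mulr_sumr -sumrB -big_split/=.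
by apply: eq_bigr => l _; exact: dotH_sqB.
Qed.

(** The square norm of t f + g is a nonnegative quadratic in t. *)
Lemma dot_prod_CauchySchwarz f g : rkhs_prod f -> rkhs_prod g ->
  dot_prod f g ^+ 2 <= dot_prod f f * dot_prod g g.
Proof.
move=> Hf Hg; apply: discriminant_le; first exact: dot_prod_ge0.
move=> t; rewrite /dot_prod !mulr_sumr -!big_split/=; apply: sumr_ge0 => l _.
have Htf := rkhsZ t (Hf l).
have := dotH_ge0 (rkhsD Htf (Hg l)).
rewrite (dotHDl Htf (Hg l) (rkhsD Htf (Hg l))) (dotHDr Htf (Hg l) Htf).
rewrite (dotHDr Htf (Hg l) (Hg l)) (dotHZl _ (Hf l) Htf) (dotHZl _ (Hf l) (Hg l)).
rewrite (dotHZr _ (Hf l) (Hf l)) (dotHZr _ (Hf l) (Hg l)).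
by rewrite (dotH_sym (Hg l) (Hf l)); congr (0 <= _); ring.
Qed.

Lemma dot_prod_unit_le f g : rkhs_prod f -> rkhs_prod g -> dot_prod f f <= 1 ->
  `|dot_prod f g| <= Num.sqrt (dot_prod g g).
Proof.
move=> Hf Hg f1; rewrite -(ler_pXn2r (n := 2))// ?nnegrE ?sqrtr_ge0//.
rewrite real_normK ?num_real// sqr_sqrtr ?dot_prod_ge0//.
apply: le_trans (dot_prod_CauchySchwarz Hf Hg) _.
by rewrite -[leRHS]mul1r ler_wpM2r ?dot_prod_ge0.
Qed.

(** Together with [dot_prod_unit_le], this says that a norm is the maximum of the
    inner products with the unit ball. The maximum is attained at the
    normalization of g, which is 0 when the norm of g is. *)
Lemma norm_prod_attained g : rkhs_prod g ->
  exists f, [/\ rkhs_prod f, dot_prod f f <= 1 &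
    dot_prod f g = Num.sqrt (dot_prod g g)].
Proof.
move=> Hg; have g0 := dot_prod_ge0 Hg.
set r := Num.sqrt (dot_prod g g).
have rr : dot_prod g g = r ^+ 2 by rewrite sqr_sqrtr.
exists (fun l x => r^-1 * g l x).
have Hf : rkhs_prod (fun l x => r^-1 * g l x) by move=> l; exact: rkhsZ.
split => //; rewrite dot_prodZl ?dot_prodZr// rr; have [->|r0] := eqVneq r 0.
- by rewrite !invr0 mul0r.
- by rewrite le_eqVlt; apply/orP; left; apply/eqP; field.
- by rewrite invr0 mul0r.
- by field.
Qed.

(** The space is given by a predicate on functions, so that finite sums have to be
    taken out of the inner product by induction. *)
Lemma rkhs_prod_mean n (g : 'I_n -> 'I_m -> T -> R) (c : R) :
  (forall i, rkhs_prod (g i)) ->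
  rkhs_prod (fun l x => c * \sum_(i < n) g i l x) /\
  forall f, rkhs_prod f ->
    dot_prod f (fun l x => c * \sum_(i < n) g i l x) =
    c * \sum_(i < n) dot_prod f (g i).
Proof.
move=> Hg; have sumH (l : 'I_m) : rkhs_set H (fun x => \sum_(i < n) g i l x) /\
    forall u, rkhs_set H u -> dotH H u (fun x => \sum_(i < n) g i l x) =
      \sum_(i < n) dotH H u (g i l).
  elim: n g Hg => [|n IHn] g Hg.
    have -> : (fun x => \sum_(i < 0) g i l x) = (fun=> 0).
      by apply/funext => x; rewrite big_ord0.
    split; first exact: rkhs0.
    by move=> u Hu; rewrite big_ord0 dotH_sym ?dotH0l//; exact: rkhs0.
  have [Hs sE] := IHn (fun i => g (widen_ord (leqnSn n) i)) (fun i => Hg _).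
  have -> : (fun x => \sum_(i < n.+1) g i l x) =
      (fun x => \sum_(i < n) g (widen_ord (leqnSn n) i) l x) \+ g ord_max l.
    by apply/funext => x; rewrite big_ord_recr.
  split; first by apply: rkhsD => //; exact: Hg.
  move=> u Hu; rewrite (dotHDr Hs _ Hu); last exact: Hg.
  by rewrite sE// big_ord_recr.
split; first by move=> l; apply: rkhsZ; have [] := sumH l.
move=> f Hf; rewrite /dot_prod exchange_big/= mulr_sumr; apply: eq_bigr => l _.
have [Hs sE] := sumH l.
by rewrite dotHZr// sE.
Qed.

End ProductRKHS.

(** * Derivatives as elements of the reproducing kernel Hilbert space *)

Section PathDerivative.
Context {R : realType} {T : Type} {k : T -> T -> R} (H : rkhs k).

(** Differentiation along a path is a bounded functional. The inner product of two
    difference quotients of the kernel sections along [gamma] is a mixed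
    difference quotient of k; when these converge to one number c, the square
    distance between two difference quotients tends to c - 2 c + c = 0, so that
    the quotients form a Cauchy family. By the reproducing property, pairing f
    with its limit g gives the derivative of f along [gamma]. *)
Lemma rkhs_path_derivative (c : R) (gamma : R -> T) :
  (forall e, 0 < e -> exists2 d, 0 < d & forall t s,
     0 < `|t| < d -> 0 < `|s| < d ->
     `|(k (gamma t) (gamma s) - k (gamma t) (gamma 0) - k (gamma 0) (gamma s)
        + k (gamma 0) (gamma 0)) / (t * s) - c| < e) ->
  exists2 g, rkhs_set H g & forall f, rkhs_set H f ->
    (fun t => t^-1 * (f (gamma t) - f (gamma 0))) @ 0^' --> dotH H f g.
Proof.
move=> mixed.
(* The difference quotients of t |-> k (gamma t) at 0. *)
pose dq t := fun y => t^-1 * (k (gamma t) y - k (gamma 0) y).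
have Hdq t : rkhs_set H (dq t).
  by apply: rkhsZ; apply: rkhsB; exact: rkhs_kernel.
have dqE f t : rkhs_set H f ->
    dotH H f (dq t) = t^-1 * (f (gamma t) - f (gamma 0)).
  move=> Hf; rewrite /dq dotHZr//; last by apply: rkhsB; exact: rkhs_kernel.
  by rewrite dotHBr ?rkhs_reproducing//; exact: rkhs_kernel.
have dqdq t s : dotH H (dq t) (dq s) =
    (k (gamma t) (gamma s) - k (gamma t) (gamma 0) - k (gamma 0) (gamma s)
        + k (gamma 0) (gamma 0)) / (t * s).
  rewrite dqE// /dq invfM; ring.
have dq_cauchy e : 0 < e -> exists2 d, 0 < d & forall t s,
    0 < `|t| < d -> 0 < `|s| < d -> dotH H (dq t \- dq s) (dq t \- dq s) < e.
  move=> e0; have [d d0 hd] := mixed (e / 4) ltac:(lra).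
  exists d => // t s ht hs.
  have := hd _ _ ht ht; have := hd _ _ ht hs; have := hd _ _ hs hs.
  rewrite -!dqdq dotH_sqB// !ltr_distl; lra.
have [g Hg cvgg] : exists2 g, rkhs_set H g &
    (fun n => dotH H (dq n.+1%:R^-1 \- g) (dq n.+1%:R^-1 \- g)) @ \oo --> (0 : R).
  apply: (rkhs_complete (u := fun n => dq n.+1%:R^-1)) => // e /dq_cauchy[d d0 hd].
  have [N _ hN] := near_infty_natSinv_lt (PosNum d0).
  exists N => i j Ni Nj; apply: hd.
    by rewrite normr_gt0 invr_eq0 pnatr_eq0/= ger0_norm ?invr_ge0//; exact: hN.
  by rewrite normr_gt0 invr_eq0 pnatr_eq0/= ger0_norm ?invr_ge0//; exact: hN.
exists g => // f Hf; apply/cvgrPdist_lt => e e0.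
pose M := dotH H f f + 1.
have M0 : 0 < M by rewrite ltr_wpDl// dotH_ge0.
have e20 : 0 < e ^+ 2 / M / 4 by rewrite !divr_gt0// exprn_gt0.
have [d d0 hd] := dq_cauchy _ e20.
have [N _ hN] := near_infty_natSinv_lt (PosNum d0).
move/cvgrPdist_lt : cvgg => /(_ _ e20)[N' _ hN'].
pose n := maxn N N'.
have n_dq : dotH H (dq n.+1%:R^-1 \- g) (dq n.+1%:R^-1 \- g) < e ^+ 2 / M / 4.
  have := hN' n (leq_maxr _ _); rewrite /= sub0r normrN.
  exact/le_lt_trans/ler_norm.
exists d => //= t; rewrite /= sub0r normrN => td t0.
have ht : 0 < `|t| < d by rewrite normr_gt0 t0.
have hn : 0 < `|n.+1%:R^-1 : R| < d.
  rewrite normr_gt0 invr_eq0 pnatr_eq0/= ger0_norm ?invr_ge0//.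
  by apply: hN; exact: leq_maxl.
rewrite -dqE// -dotHBr//.
rewrite -(ltr_pXn2r (n := 2))// ?nnegrE ?(ltW e0)//.
rewrite real_normK ?num_real//.
apply: (le_lt_trans (dotH_CauchySchwarz Hf (rkhsB Hg (Hdq t)))).
have -> : dotH H (g \- dq t) (g \- dq t) = dotH H (dq t \- g) (dq t \- g).
  by rewrite !dotH_sqB// (dotH_sym Hg (Hdq t)); ring.
have tg := dotH_sqB_le (Hdq t) (Hdq n.+1%:R^-1) Hg.
have tn := hd _ _ ht hn.
have tge : dotH H (dq t \- g) (dq t \- g) < e ^+ 2 / M by lra.
apply: (@le_lt_trans _ _ (M * dotH H (dq t \- g) (dq t \- g))).
  apply: ler_wpM2r; first exact: dotH_ge0 (rkhsB (Hdq t) Hg).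
  by rewrite /M lerDl.
by rewrite mulrC -ltr_pdivlMr.
Qed.

End PathDerivative.

Section Calculus.
Context {R : realType}.

Lemma is_derive_line (V W : normedModType R) (f : V -> W) (a e : V) (t : R) :
  derivable f (a + t *: e) e ->
  is_derive t (1 : R) (fun s : R => f (a + s *: e)) ('D_e f (a + t *: e)).
Proof.
have quotE : (fun h => h^-1 *:
    (((fun s : R => f (a + s *: e)) \o shift t) (h *: 1) - f (a + t *: e)))
  = (fun h => h^-1 *: ((f \o shift (a + t *: e)) (h *: e) - f (a + t *: e))).
  apply/funext => h /=; congr (_ *: (f _ - _)).
  by rewrite scalerDl [h *: 1]mulr1 addrCA.
by move=> df; split; rewrite /derivable /derive quotE.
Qed.

Lemma MVT_from0 (f df : R -> R) (d t : R) :
  (forall s : R, `|s| < d -> is_derive s 1 f (df s)) -> `|t| < d ->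
  exists2 s, `|s| <= `|t| & f t - f 0 = df s * t.
Proof.
move=> fd td.
have fcont (i : interval R) : (forall s, s \in i -> `|s| < d) ->
    {within [set` i], continuous f}.
  move=> i_lt; apply: derivable_within_continuous => s /i_lt sd.
  by have [] := fd _ sd.
have [t0|t0] := leP 0 t.
  have [||s] := @MVT_segment R f df 0 t t0.
  - move=> s; rewrite in_itv/= => /andP[s0 st]; apply: fd.
    by move: td; rewrite !ger0_norm ?(ltW s0)//; exact: lt_trans.
  - apply: fcont => s; rewrite in_itv/= => /andP[s0 st].
    by move: td; rewrite !ger0_norm//; exact: le_lt_trans.
  rewrite in_itv/= => /andP[s0 st] ft; exists s; last by rewrite ft subr0.
  by rewrite !ger0_norm.
have [||s] := @MVT_segment R f df t 0 (ltW t0).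
- move=> s; rewrite in_itv/= => /andP[s0 st]; apply: fd.
  by move: td; rewrite !ltr0_norm//; lra.
- apply: fcont => s; rewrite in_itv/= => /andP[s0 st].
  by move: td; rewrite !ler0_norm ?(ltW t0)//; lra.
rewrite in_itv/= => /andP[s0 st] ft; exists s; last by rewrite -opprB ft; ring.
by rewrite !ler0_norm ?(ltW t0)// lerN2.
Qed.

(** Applying the mean value theorem in the first variable and then in the second
    one writes the mixed quotient as a value of the mixed second derivative at a
    point close to (u, u), where that derivative is continuous. *)
Lemma mixed_difference_quotient (V : normedModType R) (O : set V)
    (kappa : V * V -> R) (u v : V) : open O -> O u -> Ck 2 (O `*` O) kappa ->
  exists c : R, forall e, 0 < e -> exists2 d, 0 < d & forall t s : R,
    0 < `|t| < d -> 0 < `|s| < d ->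
    `|(kappa (u + t *: v, u + s *: v) - kappa (u + t *: v, u)
       - kappa (u, u + s *: v) + kappa (u, u)) / (t * s) - c| < e.
Proof.
move=> Oopen Ou [_ kC2].
have [k1 [_ k1C1]] := kC2 (v, 0).
have [k2 [k2c _]] := k1C1 (0, v).
set D1 := 'D_(v, 0) kappa in k1C1 k2 k2c.
set D2 := 'D_(0, v) D1 in k2c.
(* The limit is the mixed second derivative at (u, u). *)
exists (D2 (u, u)) => e e0.
have line_cvg : (fun t : R => u + t *: v) @ (0 : R) --> u.
  rewrite -[X in _ --> X]addr0 -[X in _ --> _ + X](scale0r v).
  by apply: cvgD; [exact: cvg_cst|apply: cvgZr_tmp; exact: cvg_id].
have lineO : \forall t \near (0 : R), O (u + t *: v).
  exact: line_cvg (open_nbhs_nbhs (conj Oopen Ou)).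
have pair_cvg : (fun z : R * R => (u + z.1 *: v, u + z.2 *: v))
    @ ((0 : R), (0 : R)) --> (u, u).
  apply: cvg_pair => /=.
    by apply: (cvg_comp _ _ _ line_cvg); exact: cvg_fst.
  by apply: (cvg_comp _ _ _ line_cvg); exact: cvg_snd.
have D2near : \forall z \near ((0 : R), (0 : R)),
    `|D2 (u + z.1 *: v, u + z.2 *: v) - D2 (u, u)| < e.
  have /cvgrPdistC_lt /(_ e e0) := cvg_comp _ _ pair_cvg (k2c (u, u) (conj Ou Ou)).
  exact.
have [d1 /= d10 hd1] := lineO.
have /nbhs_ballP[d2 /= d20 hd2] := D2near.
exists (Num.min d1 d2); first by rewrite lt_min d10.
move=> t s /andP[t0 td] /andP[s0 sd].
have Oline r : `|r| < Num.min d1 d2 -> O (u + r *: v).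
  rewrite lt_min => /andP[rd1 _]; apply: hd1.
  by rewrite /ball_/= sub0r normrN.
have d0 : 0 < Num.min d1 d2 by rewrite lt_min d10.
have O0 : O u by [].
have lineE1 r w : (u + r *: v, w) = (u, w) + r *: (v, 0).
  by congr pair; rewrite /= scaler0 addr0.
have lineE2 r w : (w, u + r *: v) = (w, u) + r *: (0, v).
  by congr pair; rewrite /= scaler0 addr0.
have [|r rt r'] := @MVT_from0
   (fun t => kappa (u + t *: v, u + s *: v) - kappa (u + t *: v, u))
   (fun t => D1 (u + t *: v, u + s *: v) - D1 (u + t *: v, u)) _ t _ td.
  move=> r rd; have line1 w : O w ->
      is_derive r (1 : R) (fun t => kappa (u + t *: v, w)) (D1 (u + r *: v, w)).
    move=> Ow; under eq_fun do rewrite lineE1.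
    rewrite lineE1; apply: is_derive_line; apply: k1.
    by rewrite -lineE1; split => //=; exact: Oline.
  exact: is_deriveB (line1 _ (Oline _ sd)) (line1 _ O0).
have rd := le_lt_trans rt td.
have [|r1 r1s] := @MVT_from0 (fun s => D1 (u + r *: v, u + s *: v))
   (fun s => D2 (u + r *: v, u + s *: v)) _ s _ sd.
  move=> r2 r2d; under eq_fun do rewrite lineE2.
  rewrite lineE2.
  apply: is_derive_line; apply: k2; rewrite -lineE2; split => //=; exact: Oline.
have r1d := le_lt_trans r1s sd.
move: r'; rewrite /= !scale0r !addr0 => kE D1E.
have -> : (kappa (u + t *: v, u + s *: v) - kappa (u + t *: v, u)
       - kappa (u, u + s *: v) + kappa (u, u)) / (t * s) = D2 (u + r *: v, u + r1 *: v).
  have -> : kappa (u + t *: v, u + s *: v) - kappa (u + t *: v, u)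
       - kappa (u, u + s *: v) + kappa (u, u) =
     kappa (u + t *: v, u + s *: v) - kappa (u + t *: v, u)
       - (kappa (u, u + s *: v) - kappa (u, u)) by ring.
  rewrite kE D1E; field.
  by rewrite -!normr_gt0 t0 s0.
apply: (hd2 (r, r1)); split; rewrite /ball/= sub0r normrN.
  by rewrite (lt_le_trans rd)// ge_min lexx orbT.
by rewrite (lt_le_trans r1d)// ge_min lexx orbT.
Qed.

End Calculus.

Section SteinFeature.
Context {R : realType} {m : nat} {G : lieGroupType R m}.
Variables (Delta : G -> R) (D : 'I_m -> G -> 'rV[R]_m).
Variables (k : G -> G -> R) (H : rkhs k) (k_C2 : C2_kernel k).

(** The path is a straight line in the chart at x, along which [lie_deriv] is the
    derivative. *)
Lemma lie_deriv_representer (X : G -> 'rV[R]_m) (x : G) :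
  exists2 g, rkhs_set H g &
    forall f, rkhs_set H f -> lie_deriv X f x = dotH H f g.
Proof.
pose phi := chart_at x; pose u := chart_map phi x.
have phix : chart_dom phi x := chart_at_dom x.
have [c hc] := mixed_difference_quotient (X x) (chart_cod_open (c := phi))
  (chart_map_cod phix) (k_C2 x x).
have [e /hc[d d0 hd]|g Hg gE] := @rkhs_path_derivative R G k H c
    (fun t => chart_inv phi (u + t *: X x)).
  by exists d; rewrite ?scale0r ?addr0.
exists g => // f Hf; rewrite -(cvg_lim _ (gE f Hf))//.
have -> // : (fun t : R => t^-1 * (f (chart_inv phi (u + t *: X x)) -
      f (chart_inv phi (u + 0 *: X x)))) =
    (fun t => t^-1 *: (((fun w => f (chart_inv phi w)) \o shift u) (t *: X x) -
      f (chart_inv phi u))).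
  by apply/funext => t /=; rewrite scale0r addr0 [_ *: X x + u]addrC.
Qed.

(** The reproducing property of the Stein operator. Pairing with the representer g
    of the Lie derivative and with k x identifies A^l_p k_x as a combination of
    these two elements of H; the logarithmic derivatives at x are coefficients. *)
Lemma stein_feature_representer (p : G -> R) (l : 'I_m) (x : G) :
  rkhs_set H (stein_feature Delta D k p l x) /\
  forall f, rkhs_set H f ->
    dotH H f (stein_feature Delta D k p l x) = stein_dir Delta D p l f x.
Proof.
have [g Hg gE] := lie_deriv_representer (D l) x.
have ksym y z : k y z = k z y.
  by rewrite -(rkhs_reproducing _ (rkhs_kernel H y)) dotH_sym
    ?rkhs_reproducing//; exact: rkhs_kernel.
have Hx := rkhs_kernel H x.
set a := dlog (D l) p x; set b := dlog (D l) Delta x.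
have featureE : stein_feature Delta D k p l x =
    (fun y => (a + b) * k x y) \+ g.
  apply/funext => y /=; rewrite /stein_feature /stein_dir -/a -/b.
  have -> : (fun z => k z y) = k y by apply/funext => z; exact: ksym.
  rewrite gE; last exact: rkhs_kernel.
  rewrite dotH_sym ?rkhs_reproducing//; last exact: rkhs_kernel.
  by ring.
rewrite featureE; split; first by apply: rkhsD => //; exact: rkhsZ.
move=> f Hf; rewrite dotHDr//; last exact: rkhsZ.
rewrite dotHZr// rkhs_reproducing// -gE// /stein_dir -/a -/b; ring.
Qed.

End SteinFeature.

(** * A strong law of large numbers for square-integrable functions *)

Section Interpolation.
Context {R : realType}.

Lemma between_squares (n : nat) : (0 < n)%N ->
  exists j : nat, (j.+1 ^ 2 <= n < j.+2 ^ 2)%N.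
Proof.
elim: n => // -[|n] IHn _; first by exists 0%N.
have [j /andP[jn nj]] := IHn isT.
have [nj2|nj2] := ltnP n.+2 (j.+2 ^ 2); first by exists j; rewrite nj2 ltnW.
exists j.+1; rewrite nj2/=; apply: leq_ltn_trans nj _.
by rewrite ltn_exp2r.
Qed.

(** For (j+1)^2 <= n < (j+2)^2, monotonicity of S squeezes S n / n between the
    quotients at the two squares, up to the factor (j+2)^2 / (j+1)^2, which
    tends to 1. *)
Lemma cvg_mean_along_squares (S : nat -> R) (a : R) :
  {homo S : m n / (m <= n)%N >-> m <= n} -> (forall n, 0 <= S n) ->
  (fun j => S (j.+1 ^ 2)%N / (j.+1 ^ 2)%:R) @ \oo --> a ->
  (fun n => S n / n%:R) @ \oo --> a.
Proof.
move=> Smono S0 Sa.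
pose r j := S (j.+1 ^ 2)%N / (j.+1 ^ 2)%:R.
(* z j is the ratio (j+2)^2 / (j+1)^2 of consecutive squares. *)
pose z j : R := (1 + harmonic j) * (1 + harmonic j).
have z1 : z @ \oo --> (1 : R).
  have h1 : (fun j => 1 + harmonic j : R) @ \oo --> (1 : R).
    rewrite -[X in _ --> X]addr0.
    by apply: cvgD; [exact: cvg_cst|exact: cvg_harmonic].
  by rewrite -[X in _ --> X]mulr1; exact: cvgM.
have up : (fun j => r j.+1 * z j) @ \oo --> a.
  rewrite -[X in _ --> X]mulr1; apply: cvgM => //.
  by rewrite (@cvg_shiftS _ r).
have lo : (fun j => r j / z j) @ \oo --> a.
  rewrite -[X in _ --> X]divr1; apply: cvgM => //.
  by apply: cvgV => //; exact: oner_neq0.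
have zE j : z j = (j.+2 ^ 2)%:R / (j.+1 ^ 2)%:R.
  rewrite /z /harmonic/= !natrX -[j.+2%:R]natr1.
  have : j.+1%:R != 0 :> R by rewrite pnatr_eq0.
  by move: (j.+1%:R : R) => x x0; field.
apply/cvgrPdist_lt => e e0.
move/cvgrPdist_lt : up => /(_ _ e0)[N1 _ hup].
move/cvgrPdist_lt : lo => /(_ _ e0)[N2 _ hlo].
exists ((maxn N1 N2).+2 ^ 2)%N => // n /= Nn.
have n_gt0 : (0 < n)%N by apply: leq_trans Nn; rewrite expn_gt0.
have [j /andP[jn nj]] := between_squares n_gt0.
have Nj : (maxn N1 N2 <= j)%N.
  have := leq_ltn_trans Nn nj; rewrite ltn_exp2r//; exact: ltnW.
have nR : 0 < n%:R :> R by rewrite ltr0n.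
have jR : 0 < (j.+1 ^ 2)%:R :> R by rewrite ltr0n expn_gt0.
have j2R : 0 < (j.+2 ^ 2)%:R :> R by rewrite ltr0n expn_gt0.
have nup : S n / n%:R <= r j.+1 * z j.
  rewrite /r zE mulrA divfK ?gt_eqF// ler_pM ?invr_ge0 ?(ltW nR)//.
    by apply: Smono; exact: ltnW.
  by rewrite lef_pV2 ?posrE// ler_nat.
have nlo : r j / z j <= S n / n%:R.
  rewrite /r zE invfM invrK mulrACA mulVf ?gt_eqF// mulr1.
  rewrite ler_pM ?invr_ge0 ?(ltW j2R)//; first exact: Smono.
  by rewrite lef_pV2 ?posrE// ler_nat ltnW.
have := hup j (leq_trans (leq_maxl _ _) Nj).
have := hlo j (leq_trans (leq_maxr _ _) Nj).
rewrite /= !ltr_distl; lra.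
Qed.

(** Induction on the telescoping bound 2 - 1 / n. *)
Lemma sum_inv_squares_le2 (n : nat) :
  \sum_(k < n) ((k.+1 ^ 2)%:R : R)^-1 <= 2.
Proof.
suff : \sum_(k < n.+1) ((k.+1 ^ 2)%:R : R)^-1 <= 2 - n.+1%:R^-1.
  rewrite big_ord_recr/= => h; apply: le_trans (le_trans h _).
    by rewrite lerDl invr_ge0.
  by rewrite gerBl invr_ge0.
elim: n => [|n IHn]; first by rewrite big_ord1 exp1n invr1; lra.
rewrite big_ord_recr/=; apply: le_trans (lerD IHn (lexx _)) _.
rewrite natrX -[n.+2%:R]natr1.
have n1 : 0 < n.+1%:R :> R by [].
move: (n.+1%:R : R) n1 => x x0; rewrite -subr_ge0.
have -> : 2 - (x + 1)^-1 - (2 - x^-1 + ((x + 1) ^+ 2)^-1) = (x * (x + 1) ^+ 2)^-1.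
  by field; rewrite !gt_eqF//; lra.
by rewrite invr_ge0 mulr_ge0 ?exprn_ge0//; lra.
Qed.

End Interpolation.

Section PairwiseIid.
Context d (Omega : measurableType d) d' (T : measurableType d') (R : realType).
Context (P : probability Omega R).

Definition pairwise_iid (nu : probability T R) (X : nat -> {RV P >-> T}) :=
  (forall i A, measurable A -> distribution P (X i) A = nu A) /\
  (forall i j A B, i != j -> measurable A -> measurable B ->
    P (X i @^-1` A `&` X j @^-1` B) = (nu A * nu B)%E).

Variables (nu : probability T R) (X : nat -> {RV P >-> T}).
Hypothesis iidX : pairwise_iid nu X.

Lemma ge0_integral_sample (f : T -> \bar R) (i : nat) :
  measurable_fun setT f -> (forall x, 0 <= f x)%E ->
  (\int[P]_omega f (X i omega) = \int[nu]_x f x)%E.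
Proof.
move=> mf f0; have := ge0_integral_distribution (X i) mf f0.
rewrite /comp => <-; apply: eq_measure_integral => A mA _.
exact: iidX.1.
Qed.

(** Independence and the uniqueness of product measures identify the joint law of
    two distinct sample points with the product of nu with itself, to which
    Tonelli applies. *)
Lemma ge0_integral_sample_pair (f g : T -> R) (i j : nat) : i != j ->
  measurable_fun setT f -> measurable_fun setT g ->
  (forall x, 0 <= f x) -> (forall x, 0 <= g x) ->
  (\int[P]_omega (f (X i omega) * g (X j omega))%:E =
   (\int[nu]_x (f x)%:E) * (\int[nu]_x (g x)%:E))%E.
Proof.
move=> ij mf mg f0 g0.
have mXX : measurable_fun setT (fun omega => (X i omega, X j omega)).
  by apply/measurable_fun_pair => /=; exact: measurable_funP.
pose XX : {mfun Omega >-> (T * T)%type} :=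
  HB.pack (fun omega => (X i omega, X j omega)) (isMeasurableFun.Build _ _ _ _ _ mXX).
pose F (z : T * T) : \bar R := (f z.1 * g z.2)%:E.
have mF : measurable_fun setT F.
  apply/measurable_EFinP; apply: measurable_funM.
    exact: measurableT_comp mf measurable_fst.
  exact: measurableT_comp mg measurable_snd.
have F0 z : (0 <= F z)%E by rewrite lee_fin mulr_ge0.
transitivity (\int[distribution P XX]_z F z)%E.
  by rewrite ge0_integral_distribution.
transitivity (\int[(nu \x nu)%E]_z F z)%E.
  apply: eq_measure_integral => A mA _; apply/esym.
  apply: (@product_measure_unique _ _ _ _ _ nu nu (distribution P XX)) => //.
  by move=> B C mB mC; exact: iidX.2.
rewrite fubini_tonelli1//.
transitivity (\int[nu]_x ((f x)%:E * \int[nu]_y (g y)%:E))%E.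
  apply: eq_integral => x _; rewrite /fubini_F/= /F/=.
  under eq_integral do rewrite EFinM.
  rewrite ge0_integralZl ?lee_fin//; first exact/measurable_EFinP.
  by move=> y _; rewrite lee_fin.
rewrite ge0_integralZr//; first exact/measurable_EFinP.
  by move=> y _; rewrite lee_fin.
by apply: integral_ge0 => y _; rewrite lee_fin.
Qed.

End PairwiseIid.

Lemma summable_cvg0 (R : realType) (u : nat -> R) : (forall k, 0 <= u k) ->
  (\sum_(k <oo) (u k)%:E < +oo)%E -> u @ \oo --> (0 : R).
Proof.
move=> u0 usum.
have usum_fin : (\sum_(k <oo) (u k)%:E)%E \is a fin_num.
  by rewrite ge0_fin_numE//; apply: nneseries_ge0 => k _ _; rewrite lee_fin.
apply: cvg_series_cvg_0; apply: nondecreasing_is_cvgn.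
  by apply/nondecreasing_seqP => n; rewrite seriesSr lerDl.
exists (fine (\sum_(k <oo) (u k)%:E)%E) => _ [n _ <-].
rewrite -lee_fin fineK// /series/= -sumEFin.
by apply: nneseries_lim_ge => k _; rewrite lee_fin.
Qed.

Section StrongLaw.
Context d (Omega : measurableType d) d' (T : measurableType d') (R : realType).
Context (P : probability Omega R) (nu : probability T R).
Context (X : nat -> {RV P >-> T}) (iidX : pairwise_iid nu X).
Context (g : T -> R) (mg : measurable_fun setT g) (g0 : forall x, 0 <= g x).
Context (a s : R).
Hypothesis ga : (\int[nu]_x (g x)%:E = a%:E)%E.
Hypothesis gs : (\int[nu]_x (g x ^+ 2)%:E = s%:E)%E.

Let S n omega := \sum_(i < n) g (X i omega).

Let mgX i : measurable_fun setT (fun omega => g (X i omega)).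
Proof. exact: measurableT_comp mg _. Qed.

Let mS n : measurable_fun setT (S n).
Proof. exact: measurable_sum. Qed.

Let S0 n omega : 0 <= S n omega.
Proof. exact: sumr_ge0. Qed.

Lemma integral_sample_sum n : (\int[P]_omega (S n omega)%:E = (n%:R * a)%:E)%E.
Proof.
under eq_integral do rewrite /S -sumEFin.
rewrite ge0_integral_sum//; last 2 first.
- by move=> i; exact/measurable_EFinP.
- by move=> i omega _; rewrite lee_fin.
transitivity (\sum_(i < n) a%:E)%E.
  apply: eq_bigr => i _; rewrite (ge0_integral_sample iidX (f := EFin \o g))//.
  exact/measurable_EFinP.
by rewrite sumEFin sumr_const card_ord mulr_natl.
Qed.

Lemma integral_sample_sum_sqr n : (\int[P]_omega (S n omega ^+ 2)%:E =
  (n%:R * (s - a ^+ 2) + n%:R ^+ 2 * a ^+ 2)%:E)%E.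
Proof.
have pairE (i j : nat) :
    (\int[P]_omega (g (X i omega) * g (X j omega))%:E =
     (a ^+ 2 + (i == j)%:R * (s - a ^+ 2))%:E)%E.
  have [<-|ij] := eqVneq i j.
    under eq_integral do rewrite -expr2.
    rewrite (ge0_integral_sample iidX (f := fun x => (g x ^+ 2)%:E)).
    - by rewrite gs; congr EFin; rewrite mul1r; ring.
    - by apply/measurable_EFinP; exact: measurable_funX.
    - by move=> x; rewrite lee_fin sqr_ge0.
  by rewrite (ge0_integral_sample_pair iidX)// ga -EFinM mul0r addr0 expr2.
under eq_integral do rewrite /S expr2 big_distrlr/= -sumEFin.
under eq_integral do under eq_bigr do rewrite -sumEFin.
have mgg i j : measurable_fun setT (fun omega => (g (X i omega) * g (X j omega))%:E).
  by apply/measurable_EFinP; exact: measurable_funM.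
have gg0 i j omega : (0 <= (g (X i omega) * g (X j omega))%:E)%E.
  by rewrite lee_fin mulr_ge0.
rewrite ge0_integral_sum//; last 2 first.
- by move=> i; exact: emeasurable_sum.
- by move=> i omega _; exact: sume_ge0.
transitivity (\sum_(i < n) (n%:R * a ^+ 2 + (s - a ^+ 2))%:E)%E.
  apply: eq_bigr => i _; rewrite ge0_integral_sum//.
  under eq_bigr => j _ do rewrite pairE.
  rewrite sumEFin big_split/= sumr_const card_ord -mulr_suml mulr_natl.
  rewrite (bigD1 i)//= eqxx big1 ?addr0 ?mul1r//.
  move=> j ji; rewrite (_ : (i == j :> nat) = false)//.
  by rewrite eq_sym; apply/negbTE.
by rewrite sumEFin sumr_const card_ord -mulr_natl; congr EFin; rewrite -mulr_natl; ring.
Qed.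

(** Variance of a sum of uncorrelated variables. Moving the cross term
    2 n a S_n to the other side leaves an identity between nonnegative
    functions, so that no integrability has to be checked. *)
Lemma variance_sample_sum n :
  (\int[P]_omega ((S n omega - n%:R * a) ^+ 2)%:E = (n%:R * (s - a ^+ 2))%:E)%E.
Proof.
have a0 : 0 <= a by rewrite -lee_fin -ga; apply: integral_ge0 => x _; rewrite lee_fin.
have na0 : 0 <= 2 * (n%:R * a) by rewrite !mulr_ge0.
have : (\int[P]_omega (((S n omega - n%:R * a) ^+ 2)%:E +
    (2 * (n%:R * a))%:E * (S n omega)%:E) =
  \int[P]_omega ((S n omega ^+ 2)%:E + ((n%:R * a) ^+ 2)%:E))%E.
  by apply: eq_integral => omega _; rewrite -EFinM -!EFinD; congr EFin; ring.
have mSE : measurable_fun setT (fun omega => (S n omega)%:E) by exact/measurable_EFinP.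
rewrite ge0_integralD//; last 4 first.
- by move=> omega _; rewrite lee_fin sqr_ge0.
- apply/measurable_EFinP; apply: measurable_funX; exact: measurable_funB.
- by move=> omega _; rewrite -EFinM lee_fin mulr_ge0.
- exact: measurable_funeM.
rewrite ge0_integralZl_EFin//; last by move=> omega _; rewrite lee_fin.
rewrite [in RHS]ge0_integralD//; last 3 first.
- by move=> omega _; rewrite lee_fin sqr_ge0.
- by apply/measurable_EFinP; apply: measurable_funX.
- by move=> omega _; rewrite lee_fin sqr_ge0.
rewrite integral_sample_sum integral_sample_sum_sqr integral_cst//.
have P1 : P [set: Omega] = 1%E := probability_setT P.
rewrite [X in _ = (_ + _ * X)%E -> _]P1 mule1 -EFinM -EFinD.
move: (integral _ _ _) => [r| |]//; rewrite -EFinD => -[] h; congr EFin.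
by apply: (addIr (2 * (n%:R * a) * (n%:R * a))); rewrite h; ring.
Qed.

(** The mean square deviations of S_n / n from a, along n = j^2, have a finite sum;
    so the sum of the square deviations is almost surely finite and its terms
    tend to 0. *)
Lemma sample_sum_along_squares :
  {ae P, forall omega, (fun j => S (j.+1 ^ 2)%N omega / (j.+1 ^ 2)%:R) @ \oo --> a}.
Proof.
pose N j : nat := (j.+1 ^ 2)%N.
have N0 j : 0 < (N j)%:R :> R by rewrite ltr0n expn_gt0.
(* Square deviation of the mean of the first (j+1)^2 sample points. *)
pose Q j omega := (S (N j) omega - (N j)%:R * a) ^+ 2 / (N j)%:R ^+ 2.
have Q0 j omega : 0 <= Q j omega.
  by rewrite divr_ge0 ?sqr_ge0// exprn_ge0 ?(ltW (N0 j)).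
have mD j : measurable_fun setT (fun omega => (S (N j) omega - (N j)%:R * a) ^+ 2).
  by apply: measurable_funX; exact: measurable_funB.
have mQ j : measurable_fun setT (fun omega => (Q j omega)%:E).
  apply/measurable_EFinP; exact: measurable_funM.
have intQ j : (\int[P]_omega (Q j omega)%:E = ((s - a ^+ 2) * (N j)%:R^-1)%:E)%E.
  under eq_integral do rewrite /Q EFinM.
  rewrite ge0_integralZr//.
  - rewrite variance_sample_sum -EFinM; congr EFin; field.
    by rewrite gt_eqF.
  - exact/measurable_EFinP.
  - by move=> omega _; rewrite lee_fin sqr_ge0.
have sumQ_lt : (\int[P]_omega (\sum_(j <oo) (Q j omega)%:E) < +oo)%E.
  rewrite integral_nneseries//; last by move=> j omega _; rewrite lee_fin.
  apply: (@le_lt_trans _ _ (((s - a ^+ 2) * 2)%:E)); last exact: ltry.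
  apply: lime_le.
    apply: is_cvg_nneseries => j _ _.
    by apply: integral_ge0 => omega _; rewrite lee_fin.
  apply: nearW => n; under eq_bigr do rewrite intQ.
  rewrite big_mkord sumEFin lee_fin -mulr_sumr ler_wpM2l ?sum_inv_squares_le2//.
  have : (0 <= ((s - a ^+ 2) * (N 0%N)%:R^-1)%:E)%E.
    by rewrite -intQ; apply: integral_ge0 => omega _; rewrite lee_fin.
  by rewrite lee_fin /N exp1n invr1 mulr1.
have sumQ_ge0 omega : (0 <= \sum_(j <oo) (Q j omega)%:E)%E.
  by apply: nneseries_ge0 => j _ _; rewrite lee_fin.
have msumQ : measurable_fun setT (fun omega => \sum_(j <oo) (Q j omega)%:E)%E.
  by apply: ge0_emeasurable_sum => // j omega _ _; rewrite lee_fin.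
have : P.-integrable setT (fun omega => \sum_(j <oo) (Q j omega)%:E)%E.
  apply/integrableP; split => //.
  by under eq_integral do rewrite gee0_abs//.
move=> /(integrable_ae measurableT); apply: filterS => omega /(_ I) fin.
have /summable_cvg0 : (\sum_(j <oo) (Q j omega)%:E < +oo)%E.
  by rewrite -ge0_fin_numE.
move=> /(_ (Q0 ^~ omega)) Qcvg.
apply/cvgrPdist_lt => e e0.
have e2 : 0 < e ^+ 2 by rewrite exprn_gt0.
move/cvgrPdist_lt : Qcvg => /(_ _ e2); apply: filterS => j.
rewrite sub0r normrN ger0_norm// => Qe.
rewrite -(ltr_pXn2r (n := 2))// ?nnegrE ?(ltW e0)// real_normK ?num_real//.
apply: le_lt_trans Qe; rewrite /Q le_eqVlt; apply/orP; left; apply/eqP.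
by rewrite -/(N j); field; rewrite gt_eqF.
Qed.

(** For a nonnegative g, the partial sums are monotone in n, and the convergence along
    the squares propagates to all n. *)
Lemma strong_law :
  {ae P, forall omega, (fun n => S n omega / n%:R) @ \oo --> a}.
Proof.
have := sample_sum_along_squares; apply: filterS => omega.
apply: (cvg_mean_along_squares (S := S ^~ omega)) => //.
move=> m n mn; rewrite /S -!(big_mkord xpredT (fun i => g (X i omega))).
by rewrite (big_cat_nat (leq0n m) mn)//= lerDl sumr_ge0.
Qed.

End StrongLaw.

(** On a probability space, g is dominated by 1 + g^2. *)
Lemma sqr_integrable_integrable d (T : measurableType d) (R : realType)
    (nu : probability T R) (g : T -> R) :
  measurable_fun setT g ->
  nu.-integrable setT (EFin \o (fun x => g x ^+ 2)) -> nu.-integrable setT (EFin \o g).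
Proof.
move=> mg ig.
have i1 : nu.-integrable setT (EFin \o cst (1 : R)).
  exact: finite_measure_integrable_cst.
apply: (le_integrable _ _ _ (integrableD _ i1 ig)) => //.
  exact/measurable_EFinP.
move=> x _ /=; rewrite lee_fin [X in _ <= X]ger0_norm ?addr_ge0 ?sqr_ge0//.
(* From (|g x| - 1)^2 >= 0, 2 |g x| <= 1 + g x ^ 2. *)
have := sqr_ge0 (`|g x| - 1); rewrite sqrrB1 -normrX ger0_norm ?sqr_ge0//.
have := normr_ge0 (g x); lra.
Qed.

Section SampleMean.
Context d (Omega : measurableType d) d' (T : measurableType d') (R : realType).
Context (P : probability Omega R) (nu : probability T R).
Context (X : nat -> {RV P >-> T}) (iidX : pairwise_iid nu X).

Definition sample_mean (n : nat) (omega : Omega) (f : T -> R) : R :=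
  (\sum_(i < n) f (X i omega)) / n%:R.

Lemma strong_law_mean (g : T -> R) :
  measurable_fun setT g -> (forall x, 0 <= g x) ->
  nu.-integrable setT (EFin \o (fun x => g x ^+ 2)) ->
  {ae P, forall omega,
    (fun n => sample_mean n omega g) @ \oo --> \int[nu]_x g x}.
Proof.
move=> mg g0 ig2; have ig := sqr_integrable_integrable mg ig2.
apply: (strong_law iidX mg g0 (s := \int[nu]_x (g x ^+ 2))).
  by rewrite /Rintegral fineK//; exact: integrable_fin_num.
by rewrite /Rintegral fineK//; exact: integrable_fin_num ig2.
Qed.

Lemma strong_law_indic (A : set T) : measurable A ->
  {ae P, forall omega,
    (fun n => sample_mean n omega (\1_A)) @ \oo --> \int[nu]_x (\1_A x : R)}.
Proof.
move=> mA; apply: strong_law_mean => //.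
have -> : (fun x => (\1_A x : R) ^+ 2) = \1_A.
  by apply/funext => x; rewrite indicE; case: (_ \in _); rewrite ?expr1n ?expr0n.
exact: integrable_indic.
Qed.

Lemma le_sample_mean n omega (f g : T -> R) : (forall x, f x <= g x) ->
  sample_mean n omega f <= sample_mean n omega g.
Proof. by move=> fg; rewrite ler_wpM2r ?invr_ge0// ler_sum. Qed.

Lemma ler_norm_sample_mean n omega (f : T -> R) :
  `|sample_mean n omega f| <= sample_mean n omega (fun x => `|f x|).
Proof.
by rewrite normrM normfV (ger0_norm (ler0n _ n)) ler_wpM2r ?invr_ge0// ler_norm_sum.
Qed.

Lemma sample_meanD n omega (f g : T -> R) :
  sample_mean n omega (fun x => f x + g x) =
  sample_mean n omega f + sample_mean n omega g.
Proof. by rewrite /sample_mean big_split mulrDl. Qed.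

Lemma sample_meanB n omega (f g : T -> R) :
  sample_mean n omega (fun x => f x - g x) =
  sample_mean n omega f - sample_mean n omega g.
Proof. by rewrite /sample_mean sumrB mulrBl. Qed.

Lemma sample_mean_sum n omega I (r : seq I) (F : I -> T -> R) :
  sample_mean n omega (fun x => \sum_(b <- r) F b x) =
  \sum_(b <- r) sample_mean n omega (F b).
Proof. by rewrite /sample_mean exchange_big/= mulr_suml. Qed.

Lemma sample_meanZ n omega c (f : T -> R) :
  sample_mean n omega (fun x => c * f x) = c * sample_mean n omega f.
Proof. by rewrite /sample_mean -mulr_sumr mulrA. Qed.

Lemma sample_mean_cst_le n omega (c : R) : 0 <= c ->
  sample_mean n omega (fun=> c) <= c.
Proof.
move=> c0; rewrite /sample_mean sumr_const card_ord -[c *+ n]mulr_natr -mulrA.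
have [->|n0] := eqVneq n 0%N; first by rewrite mul0r mulr0.
by rewrite divff ?mulr1// pnatr_eq0.
Qed.

End SampleMean.

(** * A uniform strong law for pointwise equicontinuous classes *)

Lemma continuous_borel_measurable (R : realType) (G : ptopologicalType) (f : G -> R) :
  continuous f -> measurable_fun setT (f : borel G -> R).
Proof.
move=> /continuousP cf; apply: (measurability _ (RGenOpens.measurableE R)).
move=> _ [_ [a [b ->] <-]]; apply: measurableI => //.
by apply: sub_sigma_algebra; exact/cf/interval_open.
Qed.

(** For a property stable under shrinking, the basic open sets that have it cover
    the space. The indexing by [nat] uses an injection of the basis into [nat];
    an index outside its range gives the empty set. *)
Lemma second_countable_cover (G : topologicalType) (Q : set G -> Prop) :
  @second_countable G ->
  (forall x : G, exists2 U, nbhs x U & forall V, V `<=` U -> Q V) -> Q set0 ->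
  exists A : nat -> set G,
    [/\ forall b, open (A b), \bigcup_b A b = setT & forall b, Q (A b)].
Proof.
move=> [B /countable_injP[f finj] [Bopen Bbasis]] locQ Q0.
(* The members of the basis with number b that satisfy Q: at most one. *)
pose A b := \bigcup_(U in [set U | [/\ B U, Q U & f U = b]]) U.
have AE U : B U -> Q U -> A (f U) = U.
  move=> BU QU; apply/seteqP; split; last by move=> x Ux; exists U.
  by move=> x [V [BV QV fVU] Vx]; rewrite -(finj V U) ?inE.
exists A; split.
- by move=> b; apply: bigcup_open => U [/Bopen].
- apply/seteqP; split => // x _; have [U xU QU] := locQ x.
  have [V [BV Vx] VU] := Bbasis x U xU.
  by exists (f V) => //; rewrite AE//; exact: QU.
- move=> b; have [[U [BU QU <-]]|noU] := pselect (exists U, [/\ B U, Q U & f U = b]).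
    by rewrite AE.
  suff -> : A b = set0 by [].
  by apply/seteqP; split => // x [U UB _]; case: noU; exists U.
Qed.

Section GlivenkoCantelli.
Context {R : realType} {G : ptopologicalType}.
Context d (Omega : measurableType d) (P : probability Omega R).
Context (nu : probability (borel G) R) (X : nat -> {RV P >-> borel G}).
Context (iidX : pairwise_iid nu X) (G2 : @second_countable G).
Variables (F : set (G -> R)) (phi : G -> R).
Hypothesis mphi : measurable_fun setT (phi : borel G -> R).
Hypothesis iphi2 : nu.-integrable setT (EFin \o (fun x : borel G => phi x ^+ 2)).
Hypothesis F_le_phi : forall h x, F h -> `|h x| <= phi x.
Hypothesis F_equicontinuous : forall c e, 0 < e ->
  \forall x \near c, forall h, F h -> `|h x - h c| <= e.

Local Notation mean f := (\int[nu]_x (f : borel G -> R) x).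

Let phi0 x h : F h -> 0 <= phi x.
Proof. by move=> Fh; exact: le_trans (F_le_phi x Fh). Qed.

Let iphi : nu.-integrable setT (EFin \o (phi : borel G -> R)).
Proof. exact: sqr_integrable_integrable. Qed.

Lemma equicontinuous_member_continuous h : F h -> continuous h.
Proof.
move=> Fh c; apply/cvgrPdist_le => e e0.
by apply: filterS (F_equicontinuous c e0) => x hx; rewrite distrC hx//.
Qed.

Let F_measurable h : F h -> measurable_fun setT (h : borel G -> R).
Proof.
move=> Fh; apply: continuous_borel_measurable.
exact: equicontinuous_member_continuous.
Qed.

Lemma envelope_integrable h : F h -> nu.-integrable setT (EFin \o (h : borel G -> R)).
Proof.
move=> Fh; apply: le_integrable iphi => //.
  by apply/measurable_EFinP; exact: F_measurable.
by move=> x _ /=; rewrite lee_fin (ger0_norm (phi0 x Fh)); exact: F_le_phi.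
Qed.

(** Countably many open sets on each of which the class varies by at most e around
    some point cover G; a cell is one of them minus the previous ones. *)
Lemma equicontinuous_partition e : 0 < e ->
  exists (C : nat -> set (borel G)) (c : nat -> G),
  [/\ forall b, measurable (C b), trivIset setT C, \bigcup_b C b = setT &
      forall b x h, C b x -> F h -> `|h x - h (c b)| <= e].
Proof.
move=> e0.
pose Q (U : set G) := exists c, forall x h, U x -> F h -> `|h x - h c| <= e.
have locQ (x : G) : exists2 U : set G, nbhs x U & forall V, V `<=` U -> Q V.
  exists [set y | forall h, F h -> `|h y - h x| <= e].
    exact: F_equicontinuous.
  by move=> V VU; exists x => y h /VU; exact.
have Q0 : Q set0 by exists point.
have [A [Aopen AT AQ]] := second_countable_cover G2 locQ Q0.
have [c cP] := choice AQ.
exists (seqDU A), c; split.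
- apply: seqDU_measurable => b; apply: sub_sigma_algebra; exact: Aopen.
- exact: trivIset_seqDU.
- by rewrite -seqDU_bigcup_eq.
- by move=> b x h Cbx; exact: cP (subset_seqDU Cbx).
Qed.

(** Dominated convergence: the complements of the unions of the first N cells
    decrease to the empty set. *)
Lemma tail_integral_small (C : nat -> set (borel G)) e : 0 < e -> F !=set0 ->
  (forall b, measurable (C b)) -> \bigcup_b C b = setT ->
  exists N, mean (fun x => phi x * \1_(~` \big[setU/set0]_(b < N) C b) x) < e.
Proof.
move=> e0 F0 mC CT.
pose D N := ~` \big[setU/set0]_(b < N) C b.
have mD N : measurable (D N) by apply: measurableC; exact: bigsetU_measurable.
pose t N (x : borel G) := phi x * \1_(D N) x.
have phi_ge0 x : 0 <= phi x by have [h] := F0; exact: phi0.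
have mt N : measurable_fun setT (t N) by exact: measurable_funM.
have t_le N x : `|t N x| <= phi x.
  rewrite normrM (ger0_norm (phi_ge0 x)) indicE.
  by case: (_ \in _); rewrite ?normr1 ?normr0 ?mulr1 ?mulr0.
have : (fun N => \int[nu]_x (t N x)%:E)%E @ \oo --> (\int[nu]_(x in setT) (cst 0 x))%E.
  apply: (@dominated_cvg _ _ _ nu setT measurableT (fun N x => (t N x)%:E) _
    (EFin \o phi)) => //.
  - by move=> N; exact/measurable_EFinP.
  - move=> x _; have [b _ Cbx] : (\bigcup_b C b) x by rewrite CT.
    apply: cvg_near_cst; exists b.+1 => // N /= bN.
    rewrite /t indicE memNset ?mulr0// /D => /(_ _); apply.
    by rewrite -bigcup_mkord; exists b.
  - by move=> N x _; rewrite lee_fin t_le.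
rewrite integral0 => /fine_cvgP[tfin /cvgrPdist_lt /(_ _ e0)[N _ tN]].
exists N; have := tN N (leqnn _); rewrite /= sub0r normrN.
exact/le_lt_trans/ler_norm.
Qed.

(** Glivenko-Cantelli theorem. With finitely many cells, a member h of the class is
    replaced by the step function with value h (c b) on the cell C b; the error
    is at most e on these cells and at most the envelope elsewhere, both for the
    sample mean and for the mean. The coefficients h (c b) are bounded by the
    envelope, so that the convergence of finitely many cell frequencies bounds
    the deviation of the step functions uniformly over the class. *)
Theorem uniform_strong_law :
  {ae P, forall omega, forall e, 0 < e -> \forall n \near \oo,
     forall h, F h -> `|sample_mean X n omega h - mean h| <= e}.
Proof.
have [F0|F0] := pselect (F !=set0); last first.
  by apply: aeW => omega e _; apply: nearW => n h Fh; case: F0; exists h.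
(* The exceptional null set may depend on e: the argument is run for
   countably many e only. *)
suff aee e : 0 < e -> {ae P, forall omega, \forall n \near \oo,
     forall h, F h -> `|sample_mean X n omega h - mean h| <= 6 * e}.
  have : {ae P, forall omega, forall j : nat, \forall n \near \oo,
     forall h, F h -> `|sample_mean X n omega h - mean h| <= 6 * j.+1%:R^-1}.
    by apply: ae_foralln => j; apply: aee; rewrite invr_gt0.
  apply: filterS => omega omegaP e e0.
  have [j _ je] := near_infty_natSinv_lt (PosNum (divr_gt0 e0 (ltr0n R 6))).
  apply: filterS (omegaP j) => n nP h Fh; apply: le_trans (nP h Fh) _.
  have := je j (leqnn _); rewrite /= ltr_pdivlMr// mulrC; exact: ltW.
move=> e0.
have phi_ge0 x : 0 <= phi x by have [h] := F0; exact: phi0.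
have [C [c [mC tC CT Cc]]] := equicontinuous_partition e0.
have [N tailN] := tail_integral_small e0 F0 mC CT.
set D := ~` _ in tailN.
have mD : measurable D by apply: measurableC; exact: bigsetU_measurable.
pose t (x : borel G) := phi x * \1_D x.
have mt : measurable_fun setT t by exact: measurable_funM.
have t_ge0 x : 0 <= t x by rewrite mulr_ge0.
have t_le x : t x <= phi x.
  by rewrite /t indicE; case: (_ \in _); rewrite ?mulr1 ?mulr0.
have it2 : nu.-integrable setT (EFin \o (fun x => t x ^+ 2)).
  apply: le_integrable iphi2 => //.
    by apply/measurable_EFinP; exact: measurable_funX.
  move=> x _; rewrite /= lee_fin !ger0_norm ?sqr_ge0//.
  by rewrite ler_sqr ?nnegrE.
have it : nu.-integrable setT (EFin \o t) by exact: sqr_integrable_integrable.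
have := strong_law_mean iidX mt t_ge0 it2.
have : {ae P, forall omega, forall b,
    (fun n => sample_mean X n omega (\1_(C b))) @ \oo --> \int[nu]_x (\1_(C b) x : R)}.
  by apply: ae_foralln => b; exact: strong_law_indic.
apply: filterS2 => omega indic_cvg t_cvg.
(* Bound, common to the class, on the deviation of the step functions. *)
pose dev n := \sum_(b < N) phi (c b) *
  `|sample_mean X n omega (\1_(C b)) - \int[nu]_x (\1_(C b) x : R)|.
have dev_cvg : dev @ \oo --> (0 : R).
  rewrite [X in _ --> X](_ : _ = \sum_(b < N) phi (c b) * 0); last first.
    by rewrite big1// => b _; rewrite mulr0.
  apply: cvg_big => [|b _]; first exact: add_continuous.
  apply: cvgM; first exact: cvg_cst.
  by apply/norm_cvg0P; apply/subr_cvg0; exact: indic_cvg.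
have dev_small : \forall n \near \oo, dev n < e.
  move/cvgrPdist_lt : dev_cvg => /(_ _ e0); apply: filterS => n.
  by rewrite sub0r normrN; exact/le_lt_trans/ler_norm.
have t_small : \forall n \near \oo, sample_mean X n omega t < 2 * e.
  move/cvgrPdist_lt : t_cvg => /(_ _ e0); apply: filterS => n.
  by rewrite ltr_distl; rewrite /t in tailN *; lra.
near=> n => h Fh.
(* The step function approximating h. *)
pose sh (x : borel G) := \sum_(b < N) h (c b) * \1_(C b) x.
have h_sh x : `|h x - sh x| <= e + t x.
  have [xD|xD] := pselect (D x).
    rewrite /sh big1 ?subr0; last first.
      move=> b _; rewrite indicE memNset ?mulr0// => Cbx; apply: xD.
      by rewrite -bigcup_mkord; exists b => /=.
    rewrite /t indicE mem_set// mulr1; apply: le_trans (F_le_phi x Fh) _.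
    by rewrite lerDr ltW.
  have [b bN Cbx] : exists2 b : 'I_N, true & C b x.
    move/contrapT : xD; rewrite -bigcup_mkord => -[b /= bN Cbx].
    by exists (Ordinal bN).
  rewrite /sh (bigD1 b)//= indicE mem_set// mulr1 big1 ?addr0; last first.
    move=> i ib; rewrite indicE memNset ?mulr0// => Cix.
    have /val_inj/eqP := tC i b I I (ex_intro _ x (conj Cix Cbx)).
    by rewrite (negbTE ib).
  by apply: le_trans (Cc b x h Cbx Fh) _; rewrite lerDl.
have ish : nu.-integrable setT (EFin \o sh).
  have -> : EFin \o sh = fun x => (\sum_(b < N) (h (c b))%:E * (\1_(C b) x)%:E)%E.
    by apply/funext => x; rewrite /= /sh -sumEFin; apply: eq_bigr => b _; rewrite EFinM.
  apply: integrable_sum => // b _; apply: integrableZl => //; exact: integrable_indic.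
have ih := envelope_integrable Fh.
have iet : nu.-integrable setT (EFin \o (fun x => e + t x)).
  have ie : nu.-integrable setT (EFin \o cst e) by exact: finite_measure_integrable_cst.
  have -> : EFin \o (fun x => e + t x) = ((EFin \o cst e) \+ (EFin \o t))%E by [].
  exact: (integrableD _ ie it).
have mean_sh : mean sh = \sum_(b < N) h (c b) * \int[nu]_x (\1_(C b) x : R).
  have iC b : nu.-integrable setT (fun x => (h (c b))%:E * (\1_(C b) x)%:E)%E.
    by apply: integrableZl => //; exact: integrable_indic.
  apply: EFin_inj; rewrite /Rintegral fineK; last exact: integrable_fin_num.
  under eq_integral do rewrite /sh -sumEFin.
  rewrite integral_sum//; last by move=> b; exact: iC.
  rewrite -sumEFin; apply: eq_bigr => b _.
  rewrite EFinM fineK; last by apply: integrable_fin_num => //; exact: integrable_indic.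
  by rewrite -integralZl//; exact: integrable_indic.
have sample_h_sh : `|sample_mean X n omega h - sample_mean X n omega sh| <= 3 * e.
  rewrite -sample_meanB; apply: le_trans (ler_norm_sample_mean _ _ _ _) _.
  apply: le_trans (le_sample_mean X n omega h_sh) _.
  rewrite sample_meanD.
  have -> : 3 * e = e + 2 * e by ring.
  apply: lerD; first exact: sample_mean_cst_le (ltW e0).
  by apply: ltW; near: n.
have sh_mean : `|sample_mean X n omega sh - mean sh| <= e.
  rewrite sample_mean_sum mean_sh -sumrB; apply: le_trans (ler_norm_sum _ _ _) _.
  apply: (@le_trans _ _ (dev n)); last by apply: ltW; near: n.
  apply: ler_sum => b _; rewrite sample_meanZ -mulrBr normrM.
  by rewrite ler_wpM2r// F_le_phi.
have mean_sh_h : `|mean sh - mean h| <= 2 * e.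
  rewrite distrC -RintegralB//; apply: le_trans (le_normr_Rintegral _ _) _ => //.
    exact: (integrableB _ ih ish).
  apply: (@le_trans _ _ (\int[nu]_x (e + t x))).
    apply: le_Rintegral => //.
    exact: integrable_norm (integrableB _ ih ish).
  rewrite RintegralD//; last exact: finite_measure_integrable_cst.
  rewrite Rintegral_cst//.
  have -> : fine (nu [set: borel G]) = 1.
    by have -> : nu setT = 1%E := probability_setT nu.
  by rewrite /t in tailN *; lra.
have := ler_distD (sample_mean X n omega sh) (sample_mean X n omega h) (mean h).
have := ler_distD (mean sh) (sample_mean X n omega sh) (mean h).
lra.
Unshelve. all: by end_near. Qed.

End GlivenkoCantelli.

(** * Integration against a measure with a density *)

Section Density.
Context d (T : measurableType d) (R : realType).
Variables (mu nu : {measure set T -> \bar R}) (w : T -> R).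
Hypothesis mw : measurable_fun setT w.
Hypothesis w0 : forall x, 0 <= w x.
Hypothesis nuE : forall A, measurable A -> (nu A = \int[mu]_(x in A) (w x)%:E)%E.

Import HBNNSimple.

Let mwE : measurable_fun setT (EFin \o w).
Proof. exact/measurable_EFinP. Qed.

Lemma ge0_integral_density_nnsfun (h : {nnsfun T >-> R}) :
  (\int[nu]_x (h x)%:E = \int[mu]_x ((h x)%:E * (w x)%:E))%E.
Proof.
have mpre r : measurable (h @^-1` [set r]) by [].
transitivity (\int[nu]_x
   (\sum_(y \in range h) (y * \1_(h @^-1` [set y]) x)%:E))%E.
  by apply: eq_integral => t tE; rewrite /= fimfunE -fsumEFin.
have indich r : measurable_fun setT (fun x => (r * \1_(h @^-1` [set r]) x)%:E).
  by apply/measurable_EFinP; exact: measurable_funM.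
rewrite ge0_integral_fsum//; last by move=> m y Ey; exact: nnfun_muleindic_ge0.
transitivity (\int[mu]_x (\sum_(y \in range h)
    (y * \1_(h @^-1` [set y]) x)%:E * (w x)%:E))%E; last first.
  apply: eq_integral => x _.
  rewrite -ge0_mule_fsuml => [|y]; last exact: nnfun_muleindic_ge0.
  by rewrite fsumEFin// -(fimfunE _ x).
rewrite ge0_integral_fsum//; last 2 first.
- by move=> y; apply: emeasurable_funM.
- by move=> n y _; rewrite mule_ge0 ?lee_fin//; exact: nnfun_muleindic_ge0.
apply: eq_fsbigr => r; rewrite inE => -[x _ <-].
under eq_integral do rewrite EFinM.
under [RHS]eq_integral do rewrite EFinM -muleA.
rewrite !ge0_integralZl ?lee_fin//; last 3 first.
- by apply: emeasurable_funM => //; exact/measurable_EFinP.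
- by move=> y _; rewrite mule_ge0 ?lee_fin.
- exact/measurable_EFinP.
rewrite integral_indic// setIT nuE//; congr (_ * _)%E.
rewrite integral_mkcond; apply: eq_integral => y _.
by rewrite patchE indicE; case: (_ \in _); rewrite ?mul1e ?mul0e.
Qed.

(** By monotone convergence from simple functions. *)
Lemma ge0_integral_density (f : T -> \bar R) :
  measurable_fun setT f -> (forall x, 0 <= f x)%E ->
  (\int[nu]_x f x = \int[mu]_x (f x * (w x)%:E))%E.
Proof.
move=> mf f0; pose h := nnsfun_approx measurableT mf.
have hf x : (EFin \o h n) x @[n --> \oo] --> f x.
  by apply: cvg_nnsfun_approx.
have nd_h x a b : (a <= b)%N -> ((h a x)%:E <= (h b x)%:E)%E.
  by move=> ab; rewrite lee_fin; exact/lefP/nd_nnsfun_approx.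
have -> : (\int[nu]_x f x = limn (fun n => \int[nu]_x (h n x)%:E))%E.
  rewrite -monotone_convergence//.
  - by apply: eq_integral => x _; apply/esym/cvg_lim => //; exact: hf.
  - by move=> n; exact/measurable_EFinP.
  - by move=> n x _; rewrite lee_fin.
  - by move=> x _ a b ab; exact: nd_h.
have -> : (\int[mu]_x (f x * (w x)%:E) =
           limn (fun n => \int[mu]_x ((h n x)%:E * (w x)%:E)))%E.
  rewrite -monotone_convergence//.
  - apply: eq_integral => x _; apply/esym/cvg_lim => //.
    by apply: cvgeZr => //; exact: hf.
  - by move=> n; apply: emeasurable_funM => //; exact/measurable_EFinP.
  - by move=> n x _; rewrite mule_ge0 ?lee_fin.
  - by move=> x _ a b ab; rewrite lee_wpmul2r ?lee_fin//; exact/lefP/nd_nnsfun_approx.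
by congr (limn _); apply/funext => n; exact: ge0_integral_density_nnsfun.
Qed.

Lemma integral_density (f : T -> R) : measurable_fun setT f ->
  (\int[nu]_x (f x)%:E = \int[mu]_x (f x * w x)%:E)%E.
Proof.
move=> mf; have mfE : measurable_fun setT (EFin \o f) by exact/measurable_EFinP.
rewrite integralE [in RHS]integralE.
rewrite (ge0_integral_density (f := (EFin \o f)^\+%E))//; last exact: measurable_funepos.
rewrite (ge0_integral_density (f := (EFin \o f)^\-%E))//; last exact: measurable_funeneg.
congr (_ - _)%E; apply: eq_integral => x _.
  by rewrite !funeposE /= -!EFin_max -EFinM maxr_pMl// mul0r.
by rewrite !funenegE /= -!EFin_max -EFinM maxr_pMl// mul0r mulNr.
Qed.

Lemma integrable_density (f : T -> R) : measurable_fun setT f ->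
  mu.-integrable setT (fun x => (f x * w x)%:E) -> nu.-integrable setT (EFin \o f).
Proof.
move=> mf /integrableP[_ fw]; apply/integrableP; split; first exact/measurable_EFinP.
apply: le_lt_trans fw; rewrite (ge0_integral_density (f := fun x => `|(f x)%:E|%E))//.
  rewrite le_eqVlt; apply/orP; left; apply/eqP; apply: eq_integral => x _.
  by rewrite EFinM abseM [X in _ = (_ * X)%E]gee0_abs ?lee_fin.
by apply: measurableT_comp => //; exact/measurable_EFinP.
Qed.

End Density.

(** * The Stein discrepancies as norms of mean features *)

Section WeightedFeature.
Context {R : realType} {m : nat} {G : lieGroupType R m}.
Variables (Delta : G -> R) (D : 'I_m -> G -> 'rV[R]_m).
Variables (k : G -> G -> R) (H : rkhs k) (k_C2 : C2_kernel k).
Variables (p q w : G -> R) (w_gt0 : forall x, 0 < w x).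

(** The vector of H^m that represents evaluation at x of the Stein operator,
    weighted by the density ratio of q and w. *)
Definition weighted_feature (x : G) (l : 'I_m) : G -> R :=
  fun y => q x / w x * stein_feature Delta D k p l x y.

Lemma weighted_feature_prod x : rkhs_prod H (weighted_feature x).
Proof.
move=> l; apply: rkhsZ.
exact: (stein_feature_representer _ _ _ k_C2 _ _ _).1.
Qed.

Lemma dot_weighted_feature x y :
  dot_prod H (weighted_feature x) (weighted_feature y) = Vstat Delta D H p q w x y.
Proof.
have Hs z l := (stein_feature_representer Delta D H k_C2 p l z).1.
have -> : Vstat Delta D H p q w x y =
    q x / w x * (q y / w y) * stein_kernel Delta D H p x y.
  rewrite /Vstat; ring.
rewrite /stein_kernel mulr_sumr; apply: eq_bigr => l _.
by rewrite /weighted_feature dotHZl//; [rewrite dotHZr// mulrA|exact: rkhsZ].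
Qed.

Lemma dot_weighted_feature_stein f x : rkhs_prod H f ->
  dot_prod H f (weighted_feature x) * w x = stein Delta D p f x * q x.
Proof.
move=> Hf; rewrite /dot_prod /stein !mulr_suml; apply: eq_bigr => l _.
have [Hs sE] := stein_feature_representer Delta D H k_C2 p l x.
rewrite /weighted_feature dotHZr// sE//; field.
by rewrite gt_eqF.
Qed.

Lemma Vstat_ge0 x : 0 <= Vstat Delta D H p q w x x.
Proof.
rewrite -dot_weighted_feature; apply: dot_prod_ge0.
exact: weighted_feature_prod.
Qed.

(** The V-statistic is the square norm of the mean e of the weighted features of
    the sample, and pairing f with e gives the sample mean of the pairings. *)
Lemma wKSD2_sqr_norm n (x : nat -> G) :
  exists e, [/\ rkhs_prod H e, wKSD2 Delta D H p q w n x = dot_prod H e e &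
    forall f, rkhs_prod H f -> dot_prod H f e =
      (\sum_(i < n) dot_prod H f (weighted_feature (x i))) / n%:R].
Proof.
have [He eE] := rkhs_prod_mean n%:R^-1
  (fun i : 'I_n => weighted_feature_prod (x i)).
exists (fun l y => n%:R^-1 * \sum_(i < n) weighted_feature (x i) l y).
split=> //; last by move=> f Hf; rewrite eE// mulrC.
rewrite eE// /wKSD2 -exprVn expr2 -mulrA; congr (_ * _).
rewrite mulr_sumr; apply: eq_bigr => i _.
have dsym g : rkhs_prod H g -> dot_prod H g (weighted_feature (x i)) =
    dot_prod H (weighted_feature (x i)) g.
  move=> Hg; apply: eq_bigr => l _; apply: dotH_sym => //; exact: weighted_feature_prod.
rewrite dsym// eE; last exact: weighted_feature_prod.
by congr (_ * _); apply: eq_bigr => j _; rewrite dot_weighted_feature.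
Qed.

End WeightedFeature.

Lemma iid_samples_pairwise (R : realType) (m : nat) (G : lieGroupType R m)
    (mu : {measure set (borel G) -> \bar R}) (w : G -> R)
    d (Omega : measurableType d) (P : probability Omega R)
    (X : nat -> {RV P >-> borel G}) :
  iid_samples mu w X -> pairwise_iid (distribution P (X 0%N)) X.
Proof.
move=> [lawX indepX]; split.
  by move=> i A mA; exact: etrans (lawX i A mA) (esym (lawX 0%N A mA)).
move=> i j A B ij mA mB.
have := indepX [:: i; j] (fun l => if l == i then A else B) _ _.
rewrite /= inE ij; move=> /(_ isT).
have mAB l : measurable (if l == i then A else B) by case: ifP.
move=> /(_ mAB); rewrite big_cons big_seq1 eqxx eq_sym (negbTE ij).
have -> : \bigcap_(l in [set` [:: i; j]]) (X l @^-1` (if l == i then A else B)) =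
    X i @^-1` A `&` X j @^-1` B.
  apply/seteqP; split => omega.
    move=> h; split.
      by have := h i; rewrite /= eqxx inE eqxx; exact.
    by have := h j; rewrite /= eq_sym (negbTE ij) !inE eqxx orbT; exact.
  move=> [hA hB] l /=; rewrite !inE => /orP[/eqP ->|/eqP ->]; rewrite ?eqxx//.
  by rewrite eq_sym (negbTE ij).
move=> ->; congr (_ * _)%E.
  exact: etrans (lawX i A mA) (esym (lawX 0%N A mA)).
exact: etrans (lawX j B mB) (esym (lawX 0%N B mB)).
Qed.

(** * Uniform convergence over compact parameter sets *)

Lemma cvg_nbhs_pair (I : Type) (F : set_system I) (FF : Filter F)
    (U W : topologicalType) (f : I -> U) (g : I -> W) (a : U) (b : W) :
  f @ F --> a -> g @ F --> b -> (fun i => (f i, g i)) @ F --> (a, b).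
Proof. exact: (@cvg_pair _ _ _ F (nbhs a) (nbhs b)). Qed.

Section UniformConvergence.
Context {R : realType} {m : nat} {G : lieGroupType R m}.
Variables (mu : {measure set (borel G) -> \bar R}).
Variables (Delta : G -> R) (D : 'I_m -> G -> 'rV[R]_m).
Variables (k : G -> G -> R) (H : rkhs k) (k_C2 : C2_kernel k).
Context {Theta : metricType R}.
Variables (p : Theta -> G -> R) (q w : G -> R).
Hypothesis mw : measurable_fun setT (w : borel G -> R).
Hypothesis w_gt0 : forall x, 0 < w x.
Local Notation V theta := (Vstat Delta D H (p theta) q w).
Hypothesis V_continuous : continuous (fun z : Theta * G * G => V z.1.1 z.1.2 z.2 : R).
Hypothesis V_integrable : forall K : set Theta, compact K -> K !=set0 ->
  mu.-integrable setT (fun x : borel G =>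
    ereal_sup [set (V theta x x)%:E | theta in K] * (w x)%:E)%E.
Context d (Omega : measurableType d) (P : probability Omega R).
Variables (X : nat -> {RV P >-> borel G}) (X_iid : iid_samples mu w X).

Let nu : probability (borel G) R := distribution P (X 0%N).
Local Notation mean f := (\int[nu]_x (f : borel G -> R) x).
Local Notation KSD theta := (KSD mu Delta D H (p theta) q).
Local Notation wKSD theta := (wKSD Delta D H (p theta) q w).
Local Notation feature theta := (weighted_feature Delta D k (p theta) q w).

Let nuE (A : set (borel G)) : measurable A -> (nu A = \int[mu]_(x in A) (w x)%:E)%E.
Proof. exact: X_iid.1. Qed.

(** The class F_K of the functions h_f: the test functions of which both
    discrepancies are suprema of means. *)
Definition witnesses (K : set Theta) : set (G -> R) :=
  [set h | exists theta f, [/\ K theta, rkhs_prod H f, dot_prod H f f <= 1 &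
    h = fun x => dot_prod H f (feature theta x)]].

Definition envelope (K : set Theta) (x : G) : R :=
  Num.sqrt (fine (ereal_sup [set (V theta x x)%:E | theta in K])).

Lemma continuous_V_theta x y : continuous (fun theta => V theta x y).
Proof.
move=> theta.
apply: (@cvg_comp _ _ _ (fun t : Theta => (t, x, y))
  (fun z : Theta * G * G => V z.1.1 z.1.2 z.2 : R) _ (nbhs (theta, x, y))).
  apply: cvg_nbhs_pair => //=; last exact: cvg_cst.
  by apply: cvg_nbhs_pair => //=; exact: cvg_cst.
exact: (@V_continuous (theta, x, y)).
Qed.

(** The diagonal V(x, x) is continuous in theta, hence bounded on K. *)
Lemma ereal_sup_V_fin_num K x : compact K -> K !=set0 ->
  ereal_sup [set (V theta x x)%:E | theta in K] \is a fin_num.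
Proof.
move=> cK [theta0 K0].
have [||theta Kt tmax] := @compact_EVT_max Theta R (fun theta => V theta x x) K _ cK.
- by exists theta0.
- by apply: continuous_subspaceT; exact: continuous_V_theta.
rewrite fin_numElt; apply/andP; split.
  apply: (@lt_le_trans _ _ (V theta0 x x)%:E); first exact: ltNyr.
  by apply: ereal_sup_ubound; exists theta0.
apply: (@le_lt_trans _ _ (V theta x x)%:E); last exact: ltry.
apply: ge_ereal_sup => _ [t Kt' <-]; rewrite lee_fin; apply: tmax.
by rewrite inE.
Qed.

Lemma V_le_envelope2 K theta x : compact K -> K theta ->
  V theta x x <= fine (ereal_sup [set (V theta x x)%:E | theta in K]).
Proof.
move=> cK Kt; have Kn : K !=set0 by exists theta.
rewrite -lee_fin fineK; last exact: ereal_sup_V_fin_num.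
by apply: ereal_sup_ubound; exists theta.
Qed.

Lemma witness_le_envelope K x h : compact K -> witnesses K h ->
  `|h x| <= envelope K x.
Proof.
move=> cK [theta [f [Kt Hf f1 ->]]].
have Hx := weighted_feature_prod Delta D H k_C2 (p theta) q w x.
apply: le_trans (dot_prod_unit_le Hf Hx f1) _.
rewrite dot_weighted_feature//; apply: ler_wsqrtr; exact: V_le_envelope2.
Qed.

Lemma envelope_sqr K x : compact K -> K !=set0 ->
  envelope K x ^+ 2 = fine (ereal_sup [set (V theta x x)%:E | theta in K]).
Proof.
move=> cK [theta Kt]; rewrite sqr_sqrtr//; apply: le_trans (V_le_envelope2 x cK Kt).
exact: Vstat_ge0.
Qed.

Lemma envelope_sqr_measurable K : compact K -> K !=set0 ->
  measurable_fun setT (fun x : borel G => envelope K x ^+ 2).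
Proof.
move=> cK Kn.
have -> : (fun x : borel G => envelope K x ^+ 2) = (fun x : borel G =>
    fine (ereal_sup [set (V theta x x)%:E | theta in K] * (w x)%:E)%E * (w x)^-1).
  apply/funext => x; rewrite envelope_sqr// fineM//; last exact: ereal_sup_V_fin_num.
  by rewrite /= mulfK// gt_eqF.
apply: measurable_funM.
  apply: measurableT_comp => //; exact: measurable_int (V_integrable cK Kn).
have -> : (fun x : borel G => (w x)^-1) = (fun x => w x `^ (-1)).
  by apply/funext => x; rewrite powR_inv1// ltW.
exact: measurableT_comp (measurable_powR (-1 : R)) mw.
Qed.

Lemma envelope_measurable K : compact K -> K !=set0 ->
  measurable_fun setT (envelope K : borel G -> R).
Proof.
move=> cK Kn.
have -> : envelope K = (fun x => Num.sqrt (envelope K x ^+ 2)).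
  by apply/funext => x; rewrite sqrtr_sqr ger0_norm// sqrtr_ge0.
apply: (measurableT_comp (continuous_measurable_fun (@sqrt_continuous R))).
exact: envelope_sqr_measurable.
Qed.

Lemma envelope_sqr_integrable K : compact K -> K !=set0 ->
  nu.-integrable setT (EFin \o (fun x : borel G => envelope K x ^+ 2)).
Proof.
move=> cK Kn; apply: (integrable_density mw (fun x => ltW (w_gt0 x)) nuE).
  exact: envelope_sqr_measurable.
apply: eq_integrable (V_integrable cK Kn) => // x _.
by rewrite EFinM envelope_sqr// fineK//; exact: ereal_sup_V_fin_num.
Qed.

(** By Cauchy-Schwarz, h_f(x) - h_f(c) is at most the distance between the weighted
    features at x and c, whose square W is a combination of values of V that
    vanishes at x = c. Compactness of K makes the neighbourhood of c on which W
    is small independent of theta. *)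
Lemma witnesses_equicontinuous K c e : compact K -> 0 < e ->
  \forall x \near c, forall h, witnesses K h -> `|h x - h c| <= e.
Proof.
move=> cK e0.
pose W (x : G) theta := V theta x x - 2 * V theta x c + V theta c c.
have Wsmall : \forall x \near c, K `<=` (fun theta => W x theta < e ^+ 2).
  apply: (iffLR (compact_near_coveringP K) cK G (nbhs c)) => theta Kt.
  have Wcvg : (fun z : Theta * G => W z.2 z.1) @ (theta, c) --> W c theta.
    have V_cvg (a b : Theta * G -> G) : a @ (theta, c) --> c -> b @ (theta, c) --> c ->
        (fun z => V z.1 (a z) (b z)) @ (theta, c) --> V theta c c.
      move=> ac bc.
      apply: (@cvg_comp _ _ _ (fun z : Theta * G => (z.1, a z, b z))
        (fun z : Theta * G * G => V z.1.1 z.1.2 z.2 : R) _ (nbhs (theta, c, c))).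
        apply: cvg_nbhs_pair => //=; apply: cvg_nbhs_pair => //=; exact: cvg_fst.
      exact: (@V_continuous (theta, c, c)).
    apply: cvgD; [apply: cvgB|].
    - by apply: V_cvg; exact: cvg_snd.
    - apply: cvgM; first exact: cvg_cst.
      by apply: V_cvg; [exact: cvg_snd|exact: cvg_cst].
    - by apply: V_cvg; exact: cvg_cst.
  have W0 : W c theta = 0 by rewrite /W; ring.
  rewrite W0 in Wcvg.
  move/cvgrPdist_lt : Wcvg => /(_ (e ^+ 2)); rewrite exprn_gt0// => /(_ isT).
  by apply: filterS => z; rewrite sub0r normrN; exact/le_lt_trans/ler_norm.
apply: filterS Wsmall => x Wx h [theta [f [Kt Hf f1 ->]]].
have Hx := weighted_feature_prod Delta D H k_C2 (p theta) q w x.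
have Hc := weighted_feature_prod Delta D H k_C2 (p theta) q w c.
rewrite -dot_prodBr//.
have Hxc : rkhs_prod H (fun l => feature theta x l \- feature theta c l).
  by move=> l; exact: rkhsB.
apply: le_trans (dot_prod_unit_le Hf Hxc f1) _.
rewrite dot_prod_sqB// !dot_weighted_feature// -[leRHS]ger0_norm ?(ltW e0)//.
by rewrite -sqrtr_sqr; apply: ler_wsqrtr; exact: ltW (Wx theta Kt).
Qed.

Lemma witness_continuous K h : compact K -> witnesses K h -> continuous h.
Proof.
move=> cK; apply: (equicontinuous_member_continuous (F := witnesses K)) => c e e0.
exact: witnesses_equicontinuous.
Qed.

Lemma witness_measurable K h : compact K -> witnesses K h ->
  measurable_fun setT (h : borel G -> R).
Proof.
by move=> cK Kh; apply: continuous_borel_measurable; exact: witness_continuous Kh.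
Qed.

Lemma envelope_integrable_sample K : compact K -> K !=set0 ->
  nu.-integrable setT (EFin \o (envelope K : borel G -> R)).
Proof.
move=> cK Kn; apply: sqr_integrable_integrable; first exact: envelope_measurable.
exact: envelope_sqr_integrable.
Qed.

Lemma witness_integrable K h : compact K -> witnesses K h ->
  nu.-integrable setT (EFin \o (h : borel G -> R)).
Proof.
move=> cK Kh; have Kn : K !=set0 by have [theta [f [Kt _ _ _]]] := Kh; exists theta.
apply: le_integrable (envelope_integrable_sample cK Kn) => //.
  by apply/measurable_EFinP; exact: witness_measurable Kh.
move=> x _ /=; rewrite lee_fin [leRHS]ger0_norm ?sqrtr_ge0//.
exact: witness_le_envelope.
Qed.

(** Since h_f w = (A_p f) q, the integrals in the definition of KSD are the means of
    the h_f under the law of the sample. *)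
Lemma KSD_mean theta :
  KSD theta = ereal_sup [set (mean h)%:E | h in witnesses [set theta]].
Proof.
have cK : compact [set theta] by exact: compact_set1.
have meanE h : witnesses [set theta] h ->
    (\int[mu]_x (h x * w x)%:E)%E = (mean h)%:E.
  move=> Kh; rewrite -(integral_density mw (fun x => ltW (w_gt0 x)) nuE).
    rewrite /Rintegral fineK//; apply: integrable_fin_num => //.
    exact: witness_integrable Kh.
  exact: witness_measurable Kh.
have normE f : rkhs_prod H f ->
    (Num.sqrt (\sum_l dotH H (f l) (f l)) <= 1) = (dot_prod H f f <= 1).
  by move=> Hf; rewrite -[X in _ <= X]sqrtr1 ler_sqrt.
congr ereal_sup; apply/seteqP; split => y [].
  move=> f [Hf f1] <-; exists (fun x => dot_prod H f (feature theta x)).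
    by exists theta, f; split=> //; rewrite -normE.
  rewrite -meanE; last by exists theta, f; split=> //; rewrite -normE.
  by apply: eq_integral => x _; rewrite dot_weighted_feature_stein.
move=> h Kh <-; rewrite -(meanE h Kh); have [t [f [/= -> Hf f1 ->]]] := Kh.
exists f; first by rewrite /= normE.
apply: eq_integral => x _.
by rewrite dot_weighted_feature_stein.
Qed.

Lemma witnesses_subset K theta : K theta -> witnesses [set theta] `<=` witnesses K.
Proof. by move=> Kt h [t [f [/= -> Hf f1 ->]]]; exists theta, f. Qed.

Lemma witness_mean_le_KSD theta h : witnesses [set theta] h ->
  ((mean h)%:E <= KSD theta)%E.
Proof. by move=> Kh; rewrite KSD_mean; apply: ereal_sup_ubound; exists h. Qed.

Lemma KSD_ge0 theta : (0 <= KSD theta)%E.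
Proof.
have Kh : witnesses [set theta] (fun=> 0).
  exists theta, (fun _ _ => 0); split => //.
  - by move=> l; exact: rkhs0.
  - by rewrite /dot_prod big1// => l _; rewrite dotH0l//; exact: rkhs0.
  - apply/funext => x; rewrite /dot_prod big1// => l _; rewrite dotH0l//.
    exact: weighted_feature_prod.
apply: le_trans (witness_mean_le_KSD Kh).
by rewrite lee_fin Rintegral_ge0.
Qed.

Lemma KSD_le_envelope K theta : compact K -> K theta ->
  (KSD theta <= (mean (envelope K))%:E)%E.
Proof.
move=> cK Kt; rewrite KSD_mean.
apply: ge_ereal_sup => _ [h /(witnesses_subset Kt) Kh <-].
rewrite lee_fin; apply: le_Rintegral => //.
- exact: witness_integrable Kh.
- by apply: envelope_integrable_sample => //; exists theta.
- by move=> x _; apply: le_trans (ler_norm _) _; exact: witness_le_envelope.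
Qed.

Lemma KSD_fin_num theta : KSD theta \is a fin_num.
Proof.
rewrite ge0_fin_numE ?KSD_ge0//.
have /le_lt_trans := @KSD_le_envelope [set theta] theta (@compact_set1 _ _) erefl.
by apply; exact: ltry.
Qed.

(** Two suprema over the same class differ by no more than the terms do. The first
    one is the norm of a mean feature, attained in the unit ball. *)
Lemma wKSD_KSD_dist K theta n omega e : K theta ->
  (forall h, witnesses K h -> `|sample_mean X n omega h - mean h| <= e) ->
  `|wKSD theta n (X ^~ omega) - fine (KSD theta)| <= e.
Proof.
move=> Kt close.
have [v [Hv vE fvE]] := wKSD2_sqr_norm Delta D H k_C2 (p theta) q w n (X ^~ omega).
have wE : wKSD theta n (X ^~ omega) = Num.sqrt (dot_prod H v v) by rewrite /Defs.wKSD vE.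
have sampleE f : rkhs_prod H f ->
    sample_mean X n omega (fun x => dot_prod H f (feature theta x)) = dot_prod H f v.
  by move=> Hf; rewrite fvE.
rewrite ler_distl wE; apply/andP; split.
  rewrite lerBlDr -lee_fin fineK ?KSD_fin_num// KSD_mean.
  apply: ge_ereal_sup => _ [h Kh <-]; rewrite lee_fin.
  have := close _ (witnesses_subset Kt Kh); rewrite ler_distlC => /andP[_].
  move/le_trans; apply; rewrite lerD2r.
  have [t [f [/= -> Hf f1 ->]]] := Kh.
  rewrite sampleE//; apply: le_trans (ler_norm _) _.
  exact: dot_prod_unit_le.
have [f [Hf f1 fv]] := norm_prod_attained Hv.
have Kh : witnesses [set theta] (fun x => dot_prod H f (feature theta x)).
  by exists theta, f.
have := close _ (witnesses_subset Kt Kh).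
rewrite sampleE// fv ler_distl => /andP[_ /le_trans]; apply; rewrite lerD2r.
by rewrite -lee_fin (fineK (KSD_fin_num theta)); exact: witness_mean_le_KSD Kh.
Qed.

Lemma wKSD_cvg_KSD K : compact K ->
  {ae P, forall omega, forall e, 0 < e -> \forall n \near \oo,
     forall theta, K theta -> `|wKSD theta n (X ^~ omega) - fine (KSD theta)| <= e}.
Proof.
move=> cK; have [Kn|Kn] := pselect (K !=set0); last first.
  by apply: aeW => omega e _; apply: nearW => n theta Kt; case: Kn; exists theta.
have := uniform_strong_law (iid_samples_pairwise X_iid) lie_second_countable
  (envelope_measurable cK Kn) (envelope_sqr_integrable cK Kn)
  (fun h x => @witness_le_envelope K x h cK)
  (fun c e => @witnesses_equicontinuous K c e cK).
apply: filterS => omega unif e e0; apply: filterS (unif e e0) => n close theta Kt.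
exact: wKSD_KSD_dist Kt close.
Qed.

End UniformConvergence.

(** The entourages of R are generated by the metric. *)
Lemma near_uniform_cvg (R : realType) (U : choiceType) (K : set U)
    (f : nat -> U -> R) (g : U -> R) :
  (forall e, 0 < e -> \forall n \near \oo, forall x, K x -> `|f n x - g x| < e) ->
  {uniform K, f @ \oo --> g}.
Proof.
move=> fg Q /uniform_nbhs[E [entE EQ]].
have [e e0 eE] : exists2 e : R, 0 < e & [set xy | ball xy.1 e xy.2] `<=` E.
  by move: entE; rewrite -entourage_ballE => -[e e0 eE]; exists e.
apply: filterS (fg e e0) => n fgn; apply: EQ => x Kx; apply: eE => /=.
by rewrite /ball/= distrC; exact: fgn.
Qed.

(** |a^2 - b^2| = |a - b| (a + b), where a + b <= 2 M + 1 as soon as c <= 1. *)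
Lemma sqr_dist_lt (R : realType) (a b M c e : R) : 0 <= a -> 0 <= b <= M -> 0 < e ->
  c = Num.min 1 (e / (2 * M + 2)) -> `|a - b| <= c -> `|a ^+ 2 - b ^+ 2| < e.
Proof.
move=> a0 /andP[b0 bM] e0 cE abc.
have M2 : 0 < 2 * M + 2 by lra.
have c1 : c <= 1 by rewrite cE ge_min lexx.
have ce : c * (2 * M + 2) <= e by rewrite -ler_pdivlMr// cE ge_min lexx orbT.
have c0 : 0 < c by rewrite cE lt_min ltr01 divr_gt0.
have a_le : a <= M + 1 by move: abc; rewrite ler_distl; lra.
rewrite subr_sqr normrM (ger0_norm (addr_ge0 a0 b0)).
apply: (@le_lt_trans _ _ (c * (2 * M + 1))).
  by rewrite ler_pM ?addr_ge0//; lra.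
by apply: lt_le_trans ce; rewrite ltr_pM2l//; lra.
Qed.

Lemma dist_le_thirds (R : realType) (a b u v e : R) : `|u - a| <= e / 3 ->
  `|v - b| <= e / 3 -> `|u - v| <= e / 3 -> `|a - b| <= e.
Proof. rewrite !ler_distl; lra. Qed.

Theorem theorem6 (R : realType) (m : nat) (G : lieGroupType R m)
  (G_connected : connected [set: G])
  (mu : {measure set (borel G) -> \bar R}) (mu_haar : left_haar mu)
  (Delta : G -> R) (Delta_modular : modular_function mu Delta)
  (D : 'I_m -> G -> 'rV[R]_m) (D_basis : left_invariant_basis D)
  (k : G -> G -> R) (k_pd : positive_definite k) (H : rkhs k)
  (k_C2 : C2_kernel k) (k_universal : C0_universal H)
  (Theta : metricType R) (Theta_connected : connected [set: Theta])
  (p : Theta -> G -> R) (q w : G -> R)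
  (p_density : forall theta, density mu (p theta))
  (p_lipschitz : forall theta, locally_lipschitz (p theta))
  (q_density : density mu q) (q_lipschitz : locally_lipschitz q)
  (w_density : density mu w) (w_gt0 : forall x, 0 < w x)
  (kp_integrable : forall theta,
    let f x := Num.sqrt (stein_kernel Delta D H (p theta) x x) in
    integrable_wrt mu (p theta) f /\ integrable_wrt mu q f)
  (dlog_integrable : forall theta l,
    let f := dlog (D l) (fun x => p theta x / q x) in
    integrable_wrt mu (p theta) f /\ integrable_wrt mu q f)
  (V_continuous : continuous (fun z : Theta * G * G =>
    Vstat Delta D H (p z.1.1) q w z.1.2 z.2 : R))
  (V_integrable : forall K : set Theta, compact K -> K !=set0 ->
    mu.-integrable setT (fun x : borel G =>
      ereal_sup [set (Vstat Delta D H (p theta) q w x x)%:E | theta in K]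
        * (w x)%:E)%E)
  (d : measure_display) (Omega : measurableType d) (P : probability Omega R)
  (X : nat -> {RV P >-> borel G}) (X_iid : iid_samples mu w X) :
  [/\ forall theta, KSD mu Delta D H (p theta) q \is a fin_num,
      forall K : set Theta, compact K ->
        {ae P, forall omega,
          {uniform K,
            (fun n theta => wKSD2 Delta D H (p theta) q w n (X ^~ omega)) @ \oo
            --> (fun theta => fine (KSD mu Delta D H (p theta) q) ^+ 2)}}
    & locally_compact [set: Theta] ->
        (forall (n : nat) (x : nat -> G),
          continuous (fun theta => wKSD Delta D H (p theta) q w n x)) /\
        continuous (fun theta => fine (KSD mu Delta D H (p theta) q))].
Proof.
have mw : measurable_fun setT (w : borel G -> R) by have [_ + _] := w_density.
have KSD_fin theta : KSD mu Delta D H (p theta) q \is a fin_num.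
  exact: (KSD_fin_num k_C2 mw w_gt0 V_continuous V_integrable X_iid).
have cvgK K (cK : compact K) :=
  wKSD_cvg_KSD k_C2 mw w_gt0 V_continuous V_integrable X_iid cK.
have wKSD_continuous n (x : nat -> G) :
    continuous (fun theta => wKSD Delta D H (p theta) q w n x).
  move=> theta; apply: (@continuous_comp _ _ _
    (fun theta => wKSD2 Delta D H (p theta) q w n x) Num.sqrt).
    2: exact: sqrt_continuous.
  apply: cvgM; first exact: cvg_cst.
  apply: cvg_big => [|i _]; first exact: add_continuous.
  apply: cvg_big => [|j _]; first exact: add_continuous.
  exact: continuous_V_theta V_continuous _ _ _.
split=> //.
- move=> K cK; have := cvgK K cK; apply: filterS => omega wcvg.
  have [Kn|Kn] := pselect (K !=set0); last first.
    apply: near_uniform_cvg => e _; apply: nearW => n theta Kt.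
    by case: Kn; exists theta.
  pose M := \int[distribution P (X 0%N)]_x
    (envelope Delta D H p q w K : borel G -> R) x.
  apply: near_uniform_cvg => e e0.
  (* The precision required of wKSD for its square to be e-close. *)
  pose c : R := Num.min 1 (e / (2 * M + 2)).
  have KSD_le theta : K theta -> 0 <= fine (KSD mu Delta D H (p theta) q) <= M.
    move=> Kt; apply/andP; split.
      apply: fine_ge0.
      exact: (KSD_ge0 k_C2 mw w_gt0 V_continuous V_integrable X_iid).
    rewrite -lee_fin (fineK (KSD_fin theta)).
    exact: (KSD_le_envelope k_C2 mw w_gt0 V_continuous V_integrable X_iid).
  have M0 : 0 <= M by have [theta /KSD_le/andP[]] := Kn; exact: le_trans.
  have c0 : 0 < c by rewrite lt_min ltr01 divr_gt0// ltr_wpDl// mulr_ge0.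
  apply: filterS (wcvg c c0) => n close theta Kt.
  have wE : wKSD2 Delta D H (p theta) q w n (X ^~ omega) =
      wKSD Delta D H (p theta) q w n (X ^~ omega) ^+ 2.
    have [v [Hv vE _]] := wKSD2_sqr_norm Delta D H k_C2 (p theta) q w n (X ^~ omega).
    by rewrite /wKSD sqr_sqrtr// vE dot_prod_ge0.
  rewrite wE; apply: (@sqr_dist_lt _ _ _ M c) => //; first exact: sqrtr_ge0.
    exact: KSD_le.
  exact: close.
- move=> lcT; split=> // theta.
  have [K KN [cK _]] := lcT theta I.
  have aeP : ProperFilter (almost_everywhere P).
    apply: ae_properfilter_algebraOfSetsType.
    by have := @lte01 R; rewrite -(probability_setT P).
  (* The almost sure event has full measure, hence is nonempty. *)
  have [omega wcvg] := @filter_ex _ _ aeP _ (cvgK K cK).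
  apply/cvgrPdist_le => e e0.
  have e3 : 0 < e / 3 by rewrite divr_gt0.
  have [N _ /(_ N (leqnn _)) close] := wcvg (e / 3) e3.
  have {}KN : nbhs theta K.
    have : \forall t \near theta, [set: Theta] t -> K t := KN.
    by apply: filterS => t /(_ I).
  have Ktheta : K theta := nbhs_singleton KN.
  have wcont : \forall t \near theta, `|wKSD Delta D H (p theta) q w N (X ^~ omega) -
      wKSD Delta D H (p t) q w N (X ^~ omega)| <= e / 3.
    have := wKSD_continuous N (X ^~ omega) theta.
    by move/cvgrPdist_le => /(_ (e / 3) e3).
  apply: filterS2 KN wcont => t Kt wt.
  exact: dist_le_thirds (close _ Ktheta) (close _ Kt) wt.
Qed.
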